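(* Let $n,r\ge 2$ and $\ell\ge0$ be integers with $\ell<r$. Let $0\le j\le r-1$ be such that $j\equiv n+2(\ell-1)\pmod r$. Then: 1. If $j=r-1$, then $\boldsymbol W_{n,\ell}=\boldsymbol C_{n,\ell}$. 2. If $\ell\le j<r-1$, then $\boldsymbol W_{n,\ell}=\boldsymbol R_{n,\ell}$. 3. If $j<\ell$ and $n\ge3$, then $\boldsymbol W_{n,\ell}=\boldsymbol S_{n,\ell}\oplus\boldsymbol R_{n,\ell}$ (as vector spaces). Moreover, $\boldsymbol W_{n,\ell}$ is not a simple $B_n$-representation, and $\boldsymbol S_{n,\ell}$ is a subrepresentation isomorphic to $\boldsymbol W_{n,\ell-j-1}$. 4. If $j<\ell$ and $n=2$, then $\boldsymbol W_{2,\ell}=\boldsymbol S_{2,\ell}$.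
   Context: Let $r\ge2$, $q=e^{\pi i/r}$, $q^{1/2}=e^{\pi i/2r}$, $s=q^{r-1}$, $\{x\}=q^x-q^{-x}$, $[x]=\{x\}/\{1\}$, $[m]!=[m]\cdots[1]$, $\begin{bmatrix} a\\ b\end{bmatrix}=\frac{[a]!}{[a-b]![b]!}$. $D$ is the Hopf algebra over $\mathbb C$ generated by $E,F,k^{\pm1}$ with $E^r=F^r=0$, $k^{4r}=1$, $kE=qEk$, $kF=q^{-1}Fk$, $[E,F]=\frac{k^2-k^{-2}}{q-q^{-1}}$ and $\Delta(E)=1\otimes E+E\otimes k^2$, $\Delta(F)=k^{-2}\otimes F+F\otimes1$, $\Delta(k)=k\otimes k$. For $\alpha\in\{\pm1,\pm i\}$ and $0\le m\le r-1$, $\mathsf V^\alpha_m$ is the simple $D$-module of dimension $m+1$ with highest weight vector $u_0^\alpha$ (i.e. $Eu_0^\alpha=0$) of $k$-weight $\alpha q^{m/2}$. The modules $\mathsf V^\alpha_{r-1}$ are projective. For $0\le m\le r-2$, $\mathsf P^\alpha_m$ denotes the projective cover of $\mathsf V^\alpha_m$; it has dimension $2r$. It is generated by a weight vector $w_0^H$ of $k$-weight $\alpha q^{m/2}$ with $(FE)^2w_0^H=0$; put $w_0^S=FE\,w_0^H$ (highest weight vector of the socle $\cong\mathsf V_m^\alpha$) and $w_0^R=E^{\,r-1-m}w_0^H$. These satisfy $Ew_0^S=Ew_0^R=0$. Let $V=\mathsf V^1_{r-1}$, with basis $u_0,\dots,u_{r-1}$ ($u_{-1}=u_r=0$), $k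 u_m=q^{(r-1-2m)/2}u_m$, $Eu_m=u_{m-1}$, $Fu_m=[m+1][r-1-m]u_{m+1}$. The braid group $B_n$ acts on $V^{\otimes n}$ by $\sigma_i=1^{\otimes(i-1)}\otimes\mathsf R\otimes1^{\otimes(n-i-1)}$, where $$\mathsf R(u_i\otimes u_j)=s^{-(i+j)}\sum_{a=0}^{\min(i,r-j-1)} q^{2(i-a)(j+a)}q^{a(a-1)/2}\begin{bmatrix} a+j\\ j\end{bmatrix}\prod_{m=0}^{a-1}\{m+j+1\}\;u_{j+a}\otimes u_{i-a};$$ this commutes with the $D$-action. For $\ell\in\mathbb Z$ let $\boldsymbol V_{n,\ell}=\mathrm{span}\{u_{\varepsilon_1}\otimes\cdots\otimes u_{\varepsilon_n}:0\le\varepsilon_i\le r-1,\ \sum\varepsilon_i=\ell\}$ and $\boldsymbol W_{n,\ell}=\ker(E)\cap\boldsymbol V_{n,\ell}$. Since $V$ is projective, $V^{\otimes n}$ is a direct sum of modules isomorphic to $\mathsf V^\alpha_{r-1}$ or $\mathsf P^\alpha_m$. Fix such a decomposition, compatible with the grading $V^{\otimes n}=\bigoplus_\ell\boldsymbol V_{n,\ell}$ (each summand is a graded subspace, with homogeneous generators $w_0^H$). Then $\boldsymbol C_{n,\ell}$, $\boldsymbol S_{n,\ell}$, $\boldsymbol R_{n,\ell}$ are the subspaces of $\boldsymbol V_{n,\ell}$ spanned respectively by: the highest weight vectors $u_0^\alpha$ of the simple summands $\mathsf V^\alpha_{r-1}$; the vectors $w_0^S$ of the summands $\mathsf P_m^\alpha$;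 the vectors $w_0^R$ of the summands $\mathsf P_m^{\alpha}$ — in each case those lying in $\boldsymbol V_{n,\ell}$. (One has $\boldsymbol W_{n,\ell}=\boldsymbol C_{n,\ell}\oplus\boldsymbol S_{n,\ell}\oplus\boldsymbol R_{n,\ell}$ as vector spaces for $\ell<r$.) *)

(* Defs.v *)
From HB Require Import structures.
From mathcomp Require Import all_boot all_order all_algebra.
From mathcomp Require Import complex.
From mathcomp Require Import reals trigo.
Set Implicit Arguments.
Unset Strict Implicit.
Unset Printing Implicit Defensive.
Import Order.TTheory GRing.Theory Num.Theory.
Local Open Scope ring_scope.

Section QuantumNumbers.
Variables (R : realType) (r : nat).

(* q^{1/2} = e^{pi i / 2r}; every half-integral power q^{x/2} is [qhalf ^ x]. *)
Definition qhalf : R[i] :=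
  (cos (pi / (2 * r)%:R) +i* sin (pi / (2 * r)%:R))%C.
Definition qq : R[i] := qhalf ^+ 2.
Definition qbrace (x : int) : R[i] := qq ^ x - qq ^ (- x).
Definition qint (x : int) : R[i] := qbrace x / qbrace 1.
Definition qfact (m : nat) : R[i] := \prod_(1 <= i < m.+1) qint i%:Z.
Definition qbinom (a b : nat) : R[i] := qfact a / (qfact (a - b) * qfact b).
Definition ss : R[i] := qq ^+ (r - 1).

Definition fourth_roots : seq R[i] := [:: 1; -1; 'i; - 'i].

End QuantumNumbers.

Section DModules.
Variables (R : realType) (r : nat).
Local Notation C := R[i].
Local Notation q := (qq R r).

(* Operators for the generators E, F, k, k^-1 on a finite-dimensional space;
   the relations of D are imposed by [is_Dmodule]. *)
Record Daction := DAction {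
  Dcarrier :> vectType C;
  opE : 'End(Dcarrier);
  opF : 'End(Dcarrier);
  opk : 'End(Dcarrier);
  opkV : 'End(Dcarrier) }.

Record is_Dmodule (M : Daction) : Prop := IsDmodule {
  Drel_kV : forall v : M, opkV M (opk M v) = v;
  Drel_Vk : forall v : M, opk M (opkV M v) = v;
  Drel_Er : forall v : M, iter r (opE M) v = 0;
  Drel_Fr : forall v : M, iter r (opF M) v = 0;
  Drel_k4r : forall v : M, iter (4 * r) (opk M) v = v;
  Drel_kE : forall v : M, opk M (opE M v) = q *: opE M (opk M v);
  Drel_kF : forall v : M, opk M (opF M v) = q^-1 *: opF M (opk M v);
  Drel_EF : forall v : M, opE M (opF M v) - opF M (opE M v) =
    (q - q^-1)^-1 *: (opk M (opk M v) - opkV M (opkV M v)) }.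

Definition Dsub (M : Daction) (U : {vspace M}) : Prop :=
  [/\ (opE M @: U <= U)%VS, (opF M @: U <= U)%VS,
      (opk M @: U <= U)%VS & (opkV M @: U <= U)%VS].

Definition Dhom (M N : Daction) (f : 'Hom(M, N)) : Prop :=
  [/\ forall v, f (opE M v) = opE N (f v),
      forall v, f (opF M v) = opF N (f v),
      forall v, f (opk M v) = opk N (f v) &
      forall v, f (opkV M v) = opkV N (f v)].

Definition Dsimple (M : Daction) : Prop :=
  (fullv : {vspace M}) <> 0%VS /\
  forall U : {vspace M}, Dsub U -> U = 0%VS \/ U = fullv.

(* D is finite dimensional, so for the finite-dimensional module P it is
   equivalent to test lifting against finite-dimensional modules only. *)
Definition Dprojective (P : Daction) : Prop :=
  is_Dmodule P /\
  forall (M N : Daction) (g : 'Hom(M, N)) (f : 'Hom(P, N)),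
    is_Dmodule M -> is_Dmodule N -> Dhom g -> Dhom f -> limg g = fullv ->
    exists2 h : 'Hom(P, M), Dhom h & forall v, g (h v) = f v.

Definition is_proj_cover (P S : Daction) : Prop :=
  Dprojective P /\
  exists p : 'Hom(P, S),
    [/\ Dhom p, limg p = fullv &
        forall U : {vspace P}, Dsub U -> (p @: U)%VS = fullv -> U = fullv].

(* M is isomorphic to V^alpha_m. *)
Definition is_Vsimple (alpha : C) (m : nat) (M : Daction) : Prop :=
  [/\ is_Dmodule M, Dsimple M, \dim {:M} = m.+1 &
      exists u : M,
        [/\ u != 0, opE M u = 0 & opk M u = (alpha * qhalf R r ^+ m) *: u]].

(* M is isomorphic to P^alpha_m. *)
Definition is_Pcover (alpha : C) (m : nat) (M : Daction) : Prop :=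
  exists S : Daction, is_Vsimple alpha m S /\ is_proj_cover M S.

(* The subspace U of T is the image of an embedding of the D-module M. *)
Definition Diso_sub (M T : Daction) (U : {vspace T}) : Prop :=
  exists f : 'Hom(M, T), [/\ Dhom f, lker f = 0%VS & limg f = U].

Definition Dgenerates (T : Daction) (w : T) (U : {vspace T}) : Prop :=
  [/\ Dsub U, w \in U &
      forall N : {vspace T}, Dsub N -> w \in N -> (U <= N)%VS].

End DModules.

Section TensorPower.
Variables (R : realType) (r n : nat).
Local Notation C := R[i].
Local Notation h := (qhalf R r).
Local Notation q := (qq R r).

(* A multi-index eps stands for u_{eps 0} (x) ... (x) u_{eps (n-1)}, and a
   vector of V^{(x) n} is the function giving its coordinates. *)
Definition mindex := {ffun 'I_n -> 'I_r}.
Definition tensor := {ffun mindex -> C^o}.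

Definition kernel_fun (A : mindex -> mindex -> C) (v : tensor) : tensor :=
  [ffun eta => \sum_(eps : mindex) A eta eps * v eps].

Fact kernel_fun_is_linear A : linear (kernel_fun A).
Proof.
move=> a u v; apply/ffunP => eta; rewrite !ffunE.
rewrite /GRing.scale /= mulr_sumr -big_split /=; apply: eq_bigr => eps _.
by rewrite !ffunE /GRing.scale /= mulrDr mulrCA.
Qed.

HB.instance Definition _ A :=
  GRing.isLinear.Build C tensor tensor *:%R (kernel_fun A)
    (kernel_fun_is_linear A).

Definition kernel_op A : 'End(tensor) := linfun (kernel_fun A).

(* Column y of each matrix holds the coordinates of the image of u_y. *)
Definition matE : 'M[C]_r := \matrix_(x, y) ((y : nat) == x.+1)%:R.
Definition matF : 'M[C]_r :=
  \matrix_(x, y) (qint R r (y : nat).+1%:Z * qint R r ((r - 1)%N%:Z - y%:Z)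
                  *+ ((x : nat) == y.+1)).
Definition matk : 'M[C]_r :=
  \matrix_(x, y) (h ^ ((r - 1)%N%:Z - (2 * y)%N%:Z) *+ (x == y)).
Definition matkV : 'M[C]_r :=
  \matrix_(x, y) (h ^ (- ((r - 1)%N%:Z - (2 * y)%N%:Z)) *+ (x == y)).

(* A_0 (x) ... (x) A_{n-1} *)
Definition tensor_op (A : 'I_n -> 'M[C]_r) : 'End(tensor) :=
  kernel_op (fun eta eps => \prod_(t < n) A t (eta t) (eps t)).

(* Iterated coproducts:
   E |-> sum_t 1^{(x) t} (x) E (x) (k^2)^{(x) n-1-t},
   F |-> sum_t (k^-2)^{(x) t} (x) F (x) 1^{(x) n-1-t}. *)
Definition tensE : 'End(tensor) :=
  \sum_(t < n) tensor_op (fun t' =>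
    if (t' < t)%N then 1%:M else if t' == t then matE else matk *m matk).
Definition tensF : 'End(tensor) :=
  \sum_(t < n) tensor_op (fun t' =>
    if (t' < t)%N then matkV *m matkV else if t' == t then matF else 1%:M).
Definition tensk : 'End(tensor) := tensor_op (fun=> matk).
Definition tenskV : 'End(tensor) := tensor_op (fun=> matkV).

Definition tensD : Daction R :=
  @DAction R tensor tensE tensF tensk tenskV.

(* Coefficient of u_x (x) u_y in R(u_i (x) u_j). *)
Definition Rcoef (x y i j : nat) : C :=
  (ss R r ^+ (i + j))^-1 *
  \sum_(0 <= a < (minn i (r - j - 1)).+1)
    (q ^+ (2 * (i - a) * (j + a)) * q ^+ (a * (a - 1))./2
     * qbinom R r (a + j) j
     * \prod_(0 <= m < a) qbrace R r (m + j + 1)%N%:Z)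
    *+ ((x == j + a)%N && (y == i - a)%N).

(* The two adjacent tensor factors acted on by a generator of B_n. *)
Definition pos_l (i : 'I_n.-1) : 'I_n := widen_ord (leq_pred n) i.
Fact pos_r_subproof (i : 'I_n.-1) : (i.+1 < n)%N.
Proof. by rewrite -ltn_predRL ltn_ord. Qed.
Definition pos_r (i : 'I_n.-1) : 'I_n := Ordinal (pos_r_subproof i).

Definition sigma (i : 'I_n.-1) : 'End(tensor) :=
  kernel_op (fun eta eps =>
    Rcoef (eta (pos_l i)) (eta (pos_r i)) (eps (pos_l i)) (eps (pos_r i))
    *+ [forall t, (t != pos_l i) && (t != pos_r i) ==> (eta t == eps t)]).

(* Elements of B_n are represented by words in the generators; (i, true)
   is the generator with index i and (i, false) its inverse. *)
Definition braid_word := seq ('I_n.-1 * bool).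
Definition braid_letter (x : 'I_n.-1 * bool) : 'End(tensor) :=
  if x.2 then sigma x.1 else (sigma x.1)^-1%VF.
Definition braid_act (w : braid_word) : 'End(tensor) :=
  foldr (fun x f => (braid_letter x \o f)%VF) \1%VF w.

Definition is_subrep (U : {vspace tensor}) : Prop :=
  forall w : braid_word, (braid_act w @: U <= U)%VS.

Definition is_simple_rep (U : {vspace tensor}) : Prop :=
  [/\ is_subrep U, U <> 0%VS &
      forall U' : {vspace tensor},
        is_subrep U' -> (U' <= U)%VS -> U' = 0%VS \/ U' = U].

(* Linear maps between subspaces are given by their extensions to tensor. *)
Definition rep_iso (U U' : {vspace tensor}) : Prop :=
  [/\ is_subrep U, is_subrep U' &
      exists f : 'End(tensor),
        [/\ (f @: U)%VS = U', (lker f :&: U)%VS = 0%VS &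
            forall (w : braid_word) (v : tensor), v \in U ->
              f (braid_act w v) = braid_act w (f v)]].

Definition basis_vec (eps : mindex) : tensor := [ffun eta => (eta == eps)%:R].

Definition Vnl (l : nat) : {vspace tensor} :=
  (\sum_(eps : mindex | (\sum_(t < n) eps t == l)%N) <[basis_vec eps]>)%VS.

Definition Wnl (l : nat) : {vspace tensor} := (lker tensE :&: Vnl l)%VS.

(* The degrees occurring in V^{(x) n} are 0, ..., n(r-1). *)
Definition graded (U : {vspace tensor}) : Prop :=
  U = (\sum_(l < (n * (r - 1)).+1) (U :&: Vnl l))%VS.

(* A graded decomposition of V^{(x) n} into nC simple summands V^alpha_{r-1}
   and nP summands P^alpha_m, with chosen vectors u_0 and w_0^H. *)
Record decomposition := Decomposition {
  nC : nat;
  nP : nat;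
  Csum : 'I_nC -> {vspace tensor};
  Calpha : 'I_nC -> C;
  Cu0 : 'I_nC -> tensor;
  Psum : 'I_nP -> {vspace tensor};
  Palpha : 'I_nP -> C;
  Pm : 'I_nP -> nat;
  PwH : 'I_nP -> tensor;
  dec_full : (\sum_(i < nC) Csum i + \sum_(i < nP) Psum i)%VS = fullv;
  dec_direct : directv (\sum_(i < nC) Csum i + \sum_(i < nP) Psum i);
  dec_Cgraded : forall i, graded (Csum i);
  dec_Calpha : forall i, Calpha i \in fourth_roots R;
  dec_Ciso : forall i, exists M : Daction R,
    is_Vsimple r (Calpha i) (r - 1) M /\ @Diso_sub R M tensD (Csum i);
  dec_Cu0 : forall i,
    [/\ Cu0 i \in Csum i, Cu0 i != 0, tensE (Cu0 i) = 0 &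
        tensk (Cu0 i) = (Calpha i * h ^+ (r - 1)) *: Cu0 i];
  dec_Pgraded : forall i, graded (Psum i);
  dec_Palpha : forall i, Palpha i \in fourth_roots R;
  dec_Pm : forall i, (Pm i <= r - 2)%N;
  dec_Piso : forall i, exists M : Daction R,
    is_Pcover r (Palpha i) (Pm i) M /\ @Diso_sub R M tensD (Psum i);
  dec_PwH_hom : forall i, exists l : nat, PwH i \in Vnl l;
  dec_PwH : forall i,
    [/\ @Dgenerates R tensD (PwH i) (Psum i),
        tensk (PwH i) = (Palpha i * h ^+ Pm i) *: PwH i &
        tensF (tensE (tensF (tensE (PwH i)))) = 0] }.

Definition PwS (d : decomposition) (i : 'I_(nP d)) : tensor :=
  tensF (tensE (PwH i)).
Definition PwR (d : decomposition) (i : 'I_(nP d)) : tensor :=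
  iter (r - 1 - Pm i) tensE (PwH i).

Definition Cnl (d : decomposition) (l : nat) : {vspace tensor} :=
  (\sum_(i < nC d | Cu0 i \in Vnl l) <[Cu0 i]>)%VS.
Definition Snl (d : decomposition) (l : nat) : {vspace tensor} :=
  (\sum_(i < nP d | PwS i \in Vnl l) <[PwS i]>)%VS.
Definition Rnl (d : decomposition) (l : nat) : {vspace tensor} :=
  (\sum_(i < nP d | PwR i \in Vnl l) <[PwR i]>)%VS.

End TensorPower.

Arguments Wnl : clear implicits.

(* Main.v *)
(** [V^(x)n] is free over both [C[E]/E^r] and [C[F]/F^r], so [ker E = im E^(r-1)]
    and [ker F = im F^(r-1)], and these equalities pass to graded direct summands.
    Let a summand be generated by [w] of degree [d] with [(FE)^2 w = 0]. It lives in
    the degrees [d-(r-1), ..., d+(r-1)], hence meets [ker F] trivially below degree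
    [d] and [ker E] trivially above it; this forces [ker E] to be the span of
    [w^S = FEw], in degree [d], and [w^R = E^(r-1-m) w], in degree [d-(r-1-m)].
    Comparing [k]-weights, [W_(n,l)] contains only vectors [w^S] with [m = r-2-j]
    and [w^R] with [m = j], and no [u_0] unless [j = r-1]. When [j < l], the
    braid-equivariant operator [F^(j+1)] is injective on [W_(n,l-j-1) = R_(n,l-j-1)]
    and maps [w^R] to a nonzero multiple of [w^S], so its image is [S_(n,l)]. *)

Require Import Defs.
From HB Require Import structures.
From mathcomp Require Import all_boot all_order all_algebra.
From mathcomp Require Import complex.
From mathcomp Require Import reals trigo.
From mathcomp Require Import ring lra zify.
Set Implicit Arguments.
Unset Strict Implicit.
Unset Printing Implicit Defensive.
Import Order.TTheory GRing.Theory Num.Theory.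
Local Open Scope ring_scope.

(** * Roots of unity and quantum integers *)

(** Freeness rests on a triangularity. In the iterated coproduct of [E] only one term changes the
    last tensor entry, and it carries no power of [k]; in that of [F] the same holds for the first
    entry. A weight [alpha q^(m/2)] sees the degree only up to the fourth root of unity [alpha].
    Fourth powers remove [alpha] and leave a congruence modulo [r], which the ranges of [m] and [j]
    turn into an equality. The decomposition alone does not tell whether [S_(n,l)] exhausts
    [W_(n,l)]; for this, dimensions are compared. A vector of [ker E] is given by arbitrary
    coordinates at the multi-indices with last entry 0. For [n = 2] there is one such index of
    degree [l], so [W_(2,l)] is a line; for [n >= 3] their number grows strictly with [l < r], so
    [S_(n,l)], being the image of [W_(n,l-j-1)], is proper. Commutation of the braid generators with
    [E] and [F] is checked on coordinates: the sum defining [R] is extended to all [a < r], and what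
    remains is an identity of coefficients whose core is [{u}^2 - {v}^2 = {u+v}{u-v}]. *)

Section RootsOfUnity.
Variables (R : realType) (r : nat).
Hypothesis hr : (2 <= r)%N.
Local Notation C := R[i].
Local Notation h := (qhalf R r).
Local Notation q := (qq R r).

Lemma de_Moivre (a : R) (k : nat) :
  (cos a +i* sin a)%C ^+ k = (cos (k%:R * a) +i* sin (k%:R * a))%C.
Proof.
elim: k => [|k IH]; first by rewrite expr0 mul0r cos0 sin0.
rewrite exprS IH -natr1 mulrDl mul1r cosD sinD.
by apply/eqP; rewrite eq_complex /=; apply/andP; split; apply/eqP; ring.
Qed.

Let r_neq0 : (r%:R : R) != 0.
Proof. by rewrite pnatr_eq0 -lt0n ltnW. Qed.

Lemma qhalf_exp_2r : h ^+ (2 * r) = -1.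
Proof.
rewrite de_Moivre (_ : _ * _ = pi) ?cospi ?sinpi; last first.
  by rewrite natrM; field.
by apply/eqP; rewrite eq_complex /= oppr0 !eqxx.
Qed.

Lemma qhalf_neq0 : h != 0.
Proof.
apply/negP => /eqP h0; have := qhalf_exp_2r; rewrite h0 expr0n.
by rewrite (_ : (_ == _)%N = false); [move/eqP; rewrite eq_sym oppr_eq0 oner_eq0|lia].
Qed.

Lemma qq_neq0 : q != 0.
Proof. by rewrite expf_neq0 ?qhalf_neq0. Qed.

Lemma qq_exp_r : q ^+ r = -1.
Proof. by rewrite -exprM qhalf_exp_2r. Qed.

(** The real part of [h^(4k)] is [cos 2a] with [a = k pi / r] strictly between 0 and [pi];
    [cos 2a = 1] would force [sin a = 0]. *)
Lemma qhalf_prim (k : nat) : (0 < k < r)%N -> h ^+ (4 * k) != 1.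
Proof.
move=> /andP[k0 kr]; rewrite de_Moivre; apply/negP => /eqP [Hc _].
have r0 : (0 : R) < r%:R by rewrite ltr0n; lia.
set a : R := k%:R * pi / r%:R.
have Ha : (4 * k)%:R * (pi / (2 * r)%:R) = a *+ 2.
  by rewrite /a !natrM; field.
have : 0 < sin a.
  apply: sin_gt0_pi; apply/andP; split.
    by rewrite /a divr_gt0 // mulr_gt0 ?pi_gt0 // ltr0n.
  by rewrite /a ltr_pdivrMr // mulrC ltr_pM2l ?pi_gt0 // ltr_nat.
have := cos2Dsin2 a; rewrite Ha cos_mulr2n in Hc.
by move=> H1 H2; have : sin a ^+ 2 = 0 by [lra]; move/eqP; rewrite sqrf_eq0 gt_eqF.
Qed.

(** The exponent [4x] serves two purposes: [{x} = 0] means [q^(2x) = h^(4x) = 1], and fourth powers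
    of [k]-weights are free of [alpha]. *)
Lemma qhalf_exp_eq1 (x : int) : (h ^ (4 * x) == 1) = (r %| x)%Z.
Proof.
have h1 : h ^ (4 * r%:Z) = 1.
  rewrite (_ : 4 * r%:Z = (2 * r + 2 * r)%N); last by lia.
  by rewrite -exprnP exprD qhalf_exp_2r; ring.
rewrite {1}(divz_eq x r) mulrDr exprzDr ?unitfE ?qhalf_neq0 //.
rewrite (_ : 4 * _ = 4 * r%:Z * (x %/ r)%Z); last by ring.
rewrite -exprz_exp h1 exp1rz mul1r.
have := modz_ge0 x (_ : r%:Z != 0); have := ltz_pmod x (_ : 0 < r%:Z).
case: (x %% r)%Z (dvdz_mod0P (d := r) (m := x)) => [k|k] HP lt ge; last by lia.
have {ge}lt : (k < r)%N by lia.
case: k HP lt => [|k] HP lt.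
  by rewrite mulr0 expr0z eqxx; symmetry; apply/HP.
rewrite (_ : 4 * _ = (4 * k.+1)%N%:Z) // -exprnP (negbTE (qhalf_prim _)) //.
by symmetry; apply/negbTE/negP => /HP.
Qed.

Lemma qbrace_eq0 (x : int) : (qbrace R r x == 0) = (r %| x)%Z.
Proof.
rewrite -qhalf_exp_eq1 /qbrace subr_eq0.
rewrite -(inj_eq (mulIf (expfz_neq0 x qq_neq0))) -!expfzDr ?qq_neq0 //.
rewrite addNr expr0z /qq (exprnP h 2) exprz_exp.
by rewrite (_ : 2%:Z * (x + x) = 4 * x) //; ring.
Qed.

Lemma qbrace1_neq0 : qbrace R r 1 != 0.
Proof. by rewrite qbrace_eq0 dvdzE /= dvdn1; lia. Qed.

Lemma qint_eq0 (x : int) : (qint R r x == 0) = (r %| x)%Z.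
Proof. by rewrite /qint mulf_eq0 invr_eq0 (negbTE qbrace1_neq0) orbF qbrace_eq0. Qed.

Lemma qbraceM (a b : int) :
  qbrace R r a * qbrace R r b =
  q ^ (a + b) + q ^ (- (a + b)) - (q ^ (a - b) + q ^ (- (a - b))).
Proof.
by rewrite opprD opprB [b - a]addrC !(expfzDr _ _ qq_neq0) /qbrace; ring.
Qed.

(** Induction step for the coefficient that appears when [E] is moved past [F^t]. After
    multiplication by [{1}^2], [qbraceM] turns every product into powers of [q] that match term by
    term. *)
Lemma qint_step_F (t M : int) :
  qint R r t * qint R r (M - t + 1) + qint R r (M - 2 * t)
  = qint R r (t + 1) * qint R r (M - t).
Proof.
have b0 := qbrace1_neq0.
apply: (mulfI b0); apply: (mulfI b0).
rewrite /qint; transitivity (qbrace R r t * qbrace R r (M - t + 1)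
  + qbrace R r 1 * qbrace R r (M - 2 * t)); first by field.
transitivity (qbrace R r (t + 1) * qbrace R r (M - t)); last by field.
rewrite !qbraceM (_ : t - (M - t + 1) = - (1 + (M - 2 * t))); last by ring.
rewrite (_ : t + 1 - (M - t) = 1 - (M - 2 * t)); last by ring.
rewrite (_ : t + 1 + (M - t) = t + (M - t + 1)); last by ring.
by rewrite opprK; ring.
Qed.

Lemma qint_step_E (t M : int) :
  qint R r t * qint R r (M + t + 1) + qint R r (M + 2 * (t + 1))
  = qint R r (t + 1) * qint R r (M + t + 2).
Proof.
have b0 := qbrace1_neq0.
apply: (mulfI b0); apply: (mulfI b0).
rewrite /qint; transitivity (qbrace R r t * qbrace R r (M + t + 1)
  + qbrace R r 1 * qbrace R r (M + 2 * (t + 1))); first by field.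
transitivity (qbrace R r (t + 1) * qbrace R r (M + t + 2)); last by field.
rewrite !qbraceM (_ : 1 - (M + 2 * (t + 1)) = - (t + (M + t + 1))); last by ring.
rewrite (_ : t + 1 - (M + t + 2) = t - (M + t + 1)); last by ring.
rewrite (_ : t + 1 + (M + t + 2) = 1 + (M + 2 * (t + 1))); last by ring.
by rewrite opprK; ring.
Qed.
End RootsOfUnity.

(** * Coordinates of tensors *)

Section Coordinates.
Variables (R : realType) (r n : nat).
Hypothesis hr : (2 <= r)%N.
Local Notation C := R[i].
Local Notation h := (qhalf R r).
Local Notation q := (qq R r).
Local Notation T := (tensor R r n).
Local Notation tE := (tensE R r n).
Local Notation tF := (tensF R r n).

Definition nindex := {ffun 'I_n -> nat}.
Implicit Types (eta : nindex) (v : T) (eps : mindex r n).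

Definition nindex_of eps : nindex := [ffun t => eps t : nat].

Lemma nindex_of_inj : injective nindex_of.
Proof.
move=> e f ef; apply/ffunP => t; apply/val_inj.
by have /ffunP/(_ t) := ef; rewrite !ffunE.
Qed.

(* Coordinates extended by zero to all natural multi-indices, so that raising
   and lowering an entry is always defined. *)
Definition coord v eta : C := \sum_(eps | nindex_of eps == eta) v eps.

Lemma coordE v eps : coord v (nindex_of eps) = v eps.
Proof.
rewrite /coord (eq_bigl (pred1 eps)) ?big_pred1_eq // => e.
by rewrite (inj_eq nindex_of_inj).
Qed.

Lemma coord_out v eta t : (r <= eta t)%N -> coord v eta = 0.
Proof.
move=> rt; rewrite /coord big_pred0 // => eps; apply/negP => /eqP e.
by move: rt; rewrite -e ffunE leqNgt ltn_ord.
Qed.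

Lemma nindexP eta :
  (exists eps, eta = nindex_of eps) \/ (exists t, (r <= eta t)%N).
Proof.
case: (boolP [forall t, (eta t < r)%N]) => [/forallP H|].
  left; exists [ffun t => Ordinal (H t)]; apply/ffunP => t.
  by rewrite !ffunE.
by rewrite negb_forall => /existsP [t Ht]; right; exists t; rewrite leqNgt.
Qed.

Lemma coord_ext u v : (forall eta, coord u eta = coord v eta) -> u = v.
Proof. by move=> H; apply/ffunP => eps; rewrite -!coordE. Qed.

Lemma coord0 eta : coord 0 eta = 0.
Proof. by rewrite /coord big1 // => e _; rewrite ffunE. Qed.

Lemma coordB u v eta : coord (u - v) eta = coord u eta - coord v eta.
Proof.
by rewrite /coord -sumrB; apply: eq_bigr => e _; rewrite !ffunE.
Qed.

Definition upd eta (t : 'I_n) (x : nat) : nindex :=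
  [ffun s => if s == t then x else eta s].

(** Matrices with at most one nonzero entry per row make the operator read a single coordinate of
    [v]. A value [eta t >= r] encodes a zero row, and [coord] is then 0 as well. *)
Lemma tensor_opE (A : 'I_n -> 'M[C]_r) v eps (c : 'I_n -> C) eta :
    (forall t y, A t (eps t) y = c t *+ ((y : nat) == eta t)) ->
  tensor_op A v eps = (\prod_t c t) * coord v eta.
Proof.
move=> H; rewrite /tensor_op /kernel_op lfunE /= ffunE /coord [X in _ * X]big_mkcond.
rewrite mulr_sumr; apply: eq_bigr => e _.
case: ifPn => [/eqP e_eta|ne].
  by congr (_ * _); apply: eq_bigr => t _; rewrite H -e_eta ffunE eqxx mulr1n.
suff [t Ht] : exists t, (e t : nat) != eta t.
  by rewrite (bigD1 t) //= H (negbTE Ht) mulr0n !(mul0r, mulr0).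
apply/existsP; apply: contraR ne; rewrite negb_exists => /forallP ne.
apply/eqP/ffunP => t; rewrite ffunE; apply/eqP.
by have := ne t; rewrite negbK.
Qed.

(** The eigenvalue of [k^2] on [u_x]. *)
Definition kap (x : nat) : C := q ^ ((r - 1)%N%:Z - (2 * x)%N%:Z).

Lemma diag_mx_sqr (A : 'M[C]_r) (a : 'I_r -> C) :
  (forall x y, A x y = a x *+ (x == y)) ->
  forall x y, (A *m A) x y = a x ^+ 2 *+ (x == y).
Proof.
move=> HA x y; rewrite mxE (bigD1 x) //= !HA eqxx mulr1n big1; last first.
  by move=> z; rewrite eq_sym HA => /negbTE ->; rewrite mulr0n mul0r.
by rewrite addr0 expr2 mulrnAr.
Qed.

Lemma qhalf_sqrz (e : int) : (h ^ e) ^+ 2 = q ^ e.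
Proof. by rewrite /qq (exprnP (h ^ e) 2) (exprnP h 2) !exprz_exp mulrC. Qed.

Lemma matk2E (x y : 'I_r) :
  (matk R r *m matk R r) x y = kap x *+ (x == y).
Proof.
rewrite (@diag_mx_sqr _ (fun x => h ^ ((r - 1)%N%:Z - (2 * x)%N%:Z))).
  by rewrite qhalf_sqrz.
move=> {}x {}y; rewrite mxE; case: eqP => [->|] //.
Qed.

Lemma matkV2E (x y : 'I_r) :
  (matkV R r *m matkV R r) x y = (kap x)^-1 *+ (x == y).
Proof.
rewrite (@diag_mx_sqr _ (fun x => h ^ (- ((r - 1)%N%:Z - (2 * x)%N%:Z)))).
  by rewrite qhalf_sqrz /kap invr_expz.
by move=> {}x {}y; rewrite mxE; case: eqP => [->|].
Qed.

Lemma coord_tensE v eta :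
  coord (tE v) eta =
  \sum_(t < n) (\prod_(s < n | (t < s)%N) kap (eta s)) * coord v (upd eta t (eta t).+1).
Proof.
case: (nindexP eta) => [[eps ->]|[t Ht]]; last first.
  rewrite (coord_out _ Ht) big1 // => s _.
  by rewrite (@coord_out _ _ t) ?mulr0 // ffunE; case: eqP => [<-|]; lia.
rewrite coordE /tensE sum_lfunE sum_ffunE; apply: eq_bigr => t _.
rewrite (@tensor_opE _ _ _ (fun s => if (t < s)%N then kap (nindex_of eps s) else 1)
  (upd (nindex_of eps) t (nindex_of eps t).+1)); last first.
  move=> s y; rewrite !ffunE; case: ltngtP => [st|st|/val_inj ->].
  - by rewrite -val_eqE (ltn_eqF st) mxE -val_eqE eq_sym.
  - by rewrite -!(inj_eq (@ord_inj n)) (gtn_eqF st) matk2E -val_eqE eq_sym.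
  - by rewrite eqxx mxE.
by rewrite -big_mkcond.
Qed.

(** The coefficient in [F u_(y-1) = phi y u_y]. It vanishes at [y = 0], which neutralises the
    truncated predecessor in [coord_tensF], and at [y = r], where the predecessor [r - 1] is again a
    valid index. *)
Definition phi (y : nat) : C := qint R r y * qint R r (r%:Z - y%:Z).

Lemma coord_tensF v eta :
  coord (tF v) eta =
  \sum_(t < n) (\prod_(s < n | (s < t)%N) (kap (eta s))^-1) * phi (eta t)
     * coord v (upd eta t (eta t).-1).
Proof.
have phi0 : phi 0 = 0.
  by apply/eqP; rewrite mulf_eq0 !qint_eq0 // dvdz0.
have phir : phi r = 0.
  by apply/eqP; rewrite mulf_eq0 subrr !qint_eq0 // orbC dvdz0.
case: (nindexP eta) => [[eps ->]|[t Ht]]; last first.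
  rewrite (coord_out _ Ht) big1 // => s _.
  case: (eqVneq (eta s) r) => [->|sr]; first by rewrite phir mulr0 mul0r.
  by rewrite (@coord_out _ _ t) ?mulr0 // ffunE; case: eqP => [?|]; subst; lia.
rewrite coordE /tensF sum_lfunE sum_ffunE; apply: eq_bigr => t _.
rewrite (@tensor_opE _ _ _ (fun s => if (s < t)%N then (kap (nindex_of eps s))^-1
  else if s == t then phi (nindex_of eps s) else 1)
  (upd (nindex_of eps) t (nindex_of eps t).-1)); last first.
  move=> s y; rewrite !ffunE; case: ltngtP => [st|st|/val_inj ->].
  - by rewrite -!(inj_eq (@ord_inj n)) (ltn_eqF st) matkV2E -val_eqE eq_sym.
  - by rewrite -!(inj_eq (@ord_inj n)) (gtn_eqF st) mxE -val_eqE eq_sym.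
  - rewrite eqxx mxE /phi; case: (nat_of_ord (eps t)) => [|x] /=.
      by rewrite mulr0n -/(phi 0) phi0 mul0rn.
    rewrite eqSS eq_sym; case: eqP => [->|//]; rewrite !mulr1n.
    by congr (_ * qint _ _ _); lia.
congr (_ * _); rewrite (bigD1 t) //= ltnn eqxx mulrC; congr (_ * _).
rewrite big_mkcond [RHS]big_mkcond; apply: eq_bigr => s _.
by rewrite -val_eqE /=; case: ltngtP.
Qed.

End Coordinates.

(** * Kernels of E and F *)

Section Freeness.
Variables (R : realType) (r n : nat).
Hypothesis hr : (2 <= r)%N.
Local Notation C := R[i].
Local Notation h := (qhalf R r).
Local Notation q := (qq R r).
Local Notation T := (tensor R r n).
Local Notation tE := (tensE R r n).
Local Notation tF := (tensF R r n).
Implicit Types (eta : nindex n) (v : T) (eps : mindex r n).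

Lemma updE eta t x s : upd eta t x s = if s == t then x else eta s.
Proof. by rewrite ffunE. Qed.

Lemma upd_same eta t x : upd eta t x t = x.
Proof. by rewrite updE eqxx. Qed.

Lemma upd_upd eta t x y : upd (upd eta t x) t y = upd eta t y.
Proof. by apply/ffunP => s; rewrite !updE; case: eqP. Qed.

Lemma upd_id eta t : upd eta t (eta t) = eta.
Proof. by apply/ffunP => s; rewrite !updE; case: eqP => [->|]. Qed.

Definition of_coord (g : nindex n -> C) : T := [ffun eps => g (nindex_of eps)].

Lemma of_coordE g eta :
  (forall eta' t, (r <= eta' t)%N -> g eta' = 0) -> coord (of_coord g) eta = g eta.
Proof.
move=> g0; case: (nindexP r eta) => [[eps ->]|[t Ht]].
  by rewrite coordE ffunE.
by rewrite (coord_out _ Ht) (g0 _ _ Ht).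
Qed.

(** * The last tensor factor and the kernel of [E] *)

Section LastCoordinate.
Variable o : 'I_n.
Hypothesis ho : o.+1 = n.

(** Terms of the coproduct other than the last leave the entry at [o] unchanged, so they fall under
    the vanishing assumption; the remaining term has an empty product of weights. *)
Lemma coord_tensE_last v eta :
    (forall eta', eta' o = eta o -> coord v eta' = 0) ->
  coord (tE v) eta = coord v (upd eta o (eta o).+1).
Proof.
move=> v0; rewrite coord_tensE // (bigD1 o) //= [X in _ + X]big1 => [|t tl].
  rewrite addr0 big_pred0 ?mul1r // => s; apply/negbTE.
  by rewrite -leqNgt; case: s => s /=; lia.
by rewrite v0 ?mulr0 // updE eq_sym (negbTE tl).
Qed.

(** Induction on the last entry: once the coordinates with last entry [m] vanish, those of [E v]
    with last entry [m] are exactly those of [v] with last entry [m + 1]. *)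
Lemma ker_tensE_last v :
  tE v = 0 -> (forall eta, eta o = 0%N -> coord v eta = 0) -> v = 0.
Proof.
move=> Ev v0; apply: coord_ext => eta; rewrite coord0.
move: {2}(eta o) (erefl (eta o)) => m; elim: m eta => [|m IH] eta em; first exact: v0.
have := @coord_tensE_last v (upd eta o m).
rewrite upd_same upd_upd -em upd_id Ev coord0 => <- // eta' em'; exact: IH.
Qed.

(** The starting vector carries the coordinates of [v] at last entry 0, moved to last entry [r - 1].
    After [a] steps the last entry is at least [r - 1 - a], with equality only if every step acted
    on the last factor, where the coefficient is 1. *)
Lemma iter_tensE_last v a eta : (eta o <= r - 1 - a)%N -> (a < r)%N ->
  coord (iter a tE (of_coord (fun eta' =>
    if eta' o == (r - 1)%N then coord v (upd eta' o 0) else 0))) eta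
  = if eta o == (r - 1 - a)%N then coord v (upd eta o 0) else 0.
Proof.
elim: a eta => [|a IH] eta ea ar /=.
  rewrite subn0 of_coordE // => eta' t rt; case: eqP => // e.
  by apply: (@coord_out _ _ _ _ _ t); rewrite updE; case: eqP => // te; subst; lia.
rewrite coord_tensE_last => [|eta' e].
  rewrite IH ?upd_same ?upd_upd; [|lia..].
  by congr (if _ then _ else _); lia.
by rewrite IH ?e; [case: eqP => // ?; exfalso; lia|lia..].
Qed.

Hypothesis Er : forall v : T, iter r tE v = 0.

(** Since [E^r = 0], [E^(r-1) z] is in [ker E] too, and it agrees with [v] on last entry 0, where
    elements of [ker E] are determined. *)
Lemma ker_tensE_sub_im v : tE v = 0 -> exists z, v = iter (r - 1) tE z.
Proof.
move=> Ev; set z := of_coord (fun eta' =>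
    if eta' o == (r - 1)%N then coord v (upd eta' o 0) else 0).
exists z; apply/eqP; rewrite -subr_eq0; apply/eqP; apply: ker_tensE_last.
  by rewrite linearB /= Ev -iterS subn1 prednK ?Er ?subr0 //; lia.
move=> eta e0; rewrite coordB iter_tensE_last ?e0 ?subnn //; last by lia.
by rewrite eqxx -e0 upd_id subrr.
Qed.

End LastCoordinate.

(** * The first tensor factor and the kernel of [F] *)

Section FirstCoordinate.
Variable o : 'I_n.
Hypothesis ho : o = 0%N :> nat.

Lemma phi_neq0 y : (0 < y < r)%N -> phi R r y != 0.
Proof.
move=> /andP[y0 yr]; rewrite mulf_neq0 // qint_eq0 //.
  by rewrite dvdzE /= gtnNdvd.
rewrite (_ : r%:Z - y%:Z = (r - y)%N); last by lia.
by rewrite dvdzE /= gtnNdvd //; lia.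
Qed.

Lemma coord_tensF_first v eta :
    (forall eta', eta' o = eta o -> coord v eta' = 0) ->
  coord (tF v) eta = phi R r (eta o) * coord v (upd eta o (eta o).-1).
Proof.
move=> v0; rewrite coord_tensF // (bigD1 o) //= [X in _ + X]big1 => [|t tl].
  by rewrite addr0 big_pred0 ?mul1r // => s; rewrite ho.
by rewrite v0 ?mulr0 // updE eq_sym (negbTE tl).
Qed.

Lemma ker_tensF_first v :
  tF v = 0 -> (forall eta, eta o = (r - 1)%N -> coord v eta = 0) -> v = 0.
Proof.
move=> Fv v0; apply: coord_ext => eta; rewrite coord0.
case: (leqP r (eta o)) => [|er]; first exact: coord_out.
(* The induction descends from [r - 1]: at first entry [y + 1], [F v] reads [v] at first entry [y]
   with factor [phi (y + 1)], which is nonzero because [y + 1 < r]. *)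
move: {2}(r - 1 - eta o)%N (erefl (r - 1 - eta o)%N) => m.
elim: m eta er => [|m IH] eta er em; first by apply: v0; lia.
have := @coord_tensF_first v (upd eta o (eta o).+1).
rewrite upd_same upd_upd /= upd_id Fv coord0 => H.
have /H/esym/eqP : forall eta', eta' o = (eta o).+1 -> coord v eta' = 0.
  by move=> eta' em'; apply: IH; lia.
by rewrite mulf_eq0 (negbTE (phi_neq0 _)) => [/eqP//|]; lia.
Qed.

Lemma iter_tensF_first (c : C) v a eta : (a <= eta o)%N -> (a < r)%N ->
  coord (iter a tF (of_coord (fun eta' =>
    if eta' o == 0%N then c * coord v (upd eta' o (r - 1)) else 0))) eta
  = if eta o == a then
      c * \prod_(1 <= y < a.+1) phi R r y * coord v (upd eta o (r - 1)) else 0.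
Proof.
elim: a eta => [|a IH] eta ea ar /=.
  rewrite big_geq // mulr1 of_coordE // => eta' t rt; case: eqP => // e.
  rewrite (@coord_out _ _ _ _ _ t) ?mulr0 //.
  by rewrite updE; case: eqP => // te; subst; lia.
rewrite coord_tensF_first => [|eta' e].
  rewrite IH ?upd_same ?upd_upd; [|lia..].
  rewrite -(inj_eq succn_inj) prednK; last by lia.
  case: eqP => [->|_]; last by rewrite mulr0.
  by rewrite [in RHS]big_nat_recr //=; ring.
by rewrite IH ?e; [case: eqP => // ?; exfalso; lia|lia..].
Qed.

Hypothesis Fr : forall v : T, iter r tF v = 0.

Lemma ker_tensF_sub_im v : tF v = 0 -> exists z, v = iter (r - 1) tF z.
Proof.
(* Each application of [F] to the first factor multiplies by a value of [phi]; [p] collects the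
   [r - 1] factors, and [z] is divided by it in advance. *)
move=> Fv; set p := \prod_(1 <= y < (r - 1).+1) phi R r y.
have p0 : p != 0.
  rewrite /p big_seq; elim/big_rec: _ => [|y x]; first exact: oner_neq0.
  by rewrite mem_index_iota => yr x0; rewrite mulf_neq0 ?phi_neq0 //; lia.
set z := of_coord (fun eta' =>
    if eta' o == 0%N then p^-1 * coord v (upd eta' o (r - 1)) else 0).
exists z; apply/eqP; rewrite -subr_eq0; apply/eqP; apply: ker_tensF_first.
  by rewrite linearB /= Fv -iterS subn1 prednK ?Fr ?subr0 //; lia.
move=> eta e0; rewrite coordB iter_tensF_first ?e0 ?leqnn //; last by lia.
by rewrite eqxx mulVf // mul1r -e0 upd_id subrr.
Qed.

End FirstCoordinate.

End Freeness.

(** * Degrees *)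

Section IterLinear.
Variables (K : fieldType) (W : vectType K) (f : 'End(W)).

Lemma iter_lfun0 t : iter t f 0 = 0.
Proof. by elim: t => //= t ->; rewrite linear0. Qed.

Lemma iter_lfunZ t a v : iter t f (a *: v) = a *: iter t f v.
Proof. by elim: t => //= t ->; rewrite linearZ. Qed.

Lemma iter_lfunD t u v : iter t f (u + v) = iter t f u + iter t f v.
Proof. by elim: t => //= t ->; rewrite linearD. Qed.

Lemma iter_lfun_sum t (I : finType) (P : pred I) (F : I -> W) :
  iter t f (\sum_(i | P i) F i) = \sum_(i | P i) iter t f (F i).
Proof. by elim: t => //= t ->; rewrite linear_sum. Qed.

Lemma iter_lfun_mem (U : {vspace W}) t v :
  (forall u, u \in U -> f u \in U) -> v \in U -> iter t f v \in U.
Proof. by move=> fU vU; elim: t => //= t; apply: fU. Qed.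
End IterLinear.

Section Degrees.
Variables (R : realType) (r n : nat).
Hypotheses (hr : (2 <= r)%N).
Local Notation C := R[i].
Local Notation h := (qhalf R r).
Local Notation q := (qq R r).
Local Notation T := (tensor R r n).
Local Notation tE := (tensE R r n).
Local Notation tF := (tensF R r n).
Implicit Types (eta : nindex n) (u v : T) (eps : mindex r n) (x y : int).

Definition degree eta : int := (\sum_t eta t)%N%:Z.

(** Indexed by all integers, so that [E] and [F] shift the index without side conditions; at a
    negative index the projection is 0. *)
Definition hproj x v : T :=
  [ffun eps => if degree (nindex_of eps) == x then v eps else 0].

Fact hproj_is_linear x : linear (hproj x).
Proof.
move=> a u v; apply/ffunP => eps; rewrite !ffunE.
by case: ifP => _; rewrite ?scaler0 ?addr0.
Qed.
HB.instance Definition _ x :=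
  GRing.isLinear.Build C T T *:%R (hproj x) (hproj_is_linear x).

Lemma coord_hproj x v eta :
  coord (hproj x v) eta = if degree eta == x then coord v eta else 0.
Proof.
case: (nindexP r eta) => [[eps ->]|[t Ht]]; first by rewrite !coordE ffunE.
by rewrite !(coord_out _ Ht) if_same.
Qed.

Lemma degree_upd eta t (a : nat) :
  degree (upd eta t a) = degree eta + a%:Z - (eta t)%:Z.
Proof.
rewrite /degree (bigD1 t) //= [in RHS](bigD1 t) //= upd_same.
rewrite (eq_bigr eta) => [|s st]; first by rewrite !PoszD; ring.
by rewrite updE (negbTE st).
Qed.

Lemma tensE_hproj x v : tE (hproj x v) = hproj (x - 1) (tE v).
Proof.
apply: coord_ext => eta; rewrite coord_hproj !coord_tensE //.
transitivity (\sum_(t < n) if degree eta == x - 1 then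
  (\prod_(s < n | (t < s)%N) kap R r (eta s)) * coord v (upd eta t (eta t).+1) else 0).
  apply: eq_bigr => t _; rewrite coord_hproj degree_upd.
  rewrite (_ : (_ == x) = (degree eta == x - 1)); last by lia.
  by case: ifP; rewrite ?mulr0.
by case: ifP => _ //; rewrite big1.
Qed.

Lemma phi0 : phi R r 0 = 0.
Proof. by apply/eqP; rewrite mulf_eq0 !qint_eq0 // dvdz0. Qed.

Lemma tensF_hproj x v : tF (hproj x v) = hproj (x + 1) (tF v).
Proof.
apply: coord_ext => eta; rewrite coord_hproj !coord_tensF //.
transitivity (\sum_(t < n) if degree eta == x + 1 then
  (\prod_(s < n | (s < t)%N) (kap R r (eta s))^-1) * phi R r (eta t)
     * coord v (upd eta t (eta t).-1) else 0).
  apply: eq_bigr => t _; case: (posnP (eta t)) => [->|et].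
    by rewrite phi0 mulr0 !mul0r if_same.
  rewrite coord_hproj degree_upd.
  rewrite (_ : (_ == x) = (degree eta == x + 1)); last by lia.
  by case: ifP; rewrite ?mulr0.
by case: ifP => _ //; rewrite big1.
Qed.

Lemma iter_tensE_hproj t x v :
  iter t tE (hproj x v) = hproj (x - t%:Z) (iter t tE v).
Proof.
by elim: t => [|t IH] /=; rewrite ?subr0 // IH tensE_hproj; congr (hproj _ _); lia.
Qed.

Lemma iter_tensF_hproj t x v :
  iter t tF (hproj x v) = hproj (x + t%:Z) (iter t tF v).
Proof.
by elim: t => [|t IH] /=; rewrite ?addr0 // IH tensF_hproj; congr (hproj _ _); lia.
Qed.

Definition homog x v := hproj x v = v.

Lemma homogP x v :
  homog x v <-> forall eps, degree (nindex_of eps) != x -> v eps = 0.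
Proof.
split=> [<- eps /negbTE e|H]; first by rewrite ffunE e.
by apply/ffunP => eps; rewrite ffunE; case: eqP => // /eqP /H.
Qed.

Lemma hprojK x y v : hproj x (hproj y v) = if x == y then hproj y v else 0.
Proof.
case: (eqVneq x y) => [->|xy]; apply/ffunP => eps; rewrite !ffunE.
  by case: (degree _ == y).
by case: eqP => // ->; rewrite (negbTE xy).
Qed.

Lemma homog_hproj x v : homog x (hproj x v).
Proof. by rewrite /homog hprojK eqxx. Qed.

Lemma homog_tensE x v : homog x v -> homog (x - 1) (tE v).
Proof. by move=> hv; rewrite /homog -tensE_hproj hv. Qed.

Lemma homog_tensF x v : homog x v -> homog (x + 1) (tF v).
Proof. by move=> hv; rewrite /homog -tensF_hproj hv. Qed.

Lemma homog_iterE t x v : homog x v -> homog (x - t%:Z) (iter t tE v).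
Proof. by move=> hv; rewrite /homog -iter_tensE_hproj hv. Qed.

Lemma homog_iterF t x v : homog x v -> homog (x + t%:Z) (iter t tF v).
Proof. by move=> hv; rewrite /homog -iter_tensF_hproj hv. Qed.

Lemma homog_inj x y v : homog x v -> homog y v -> v != 0 -> x = y.
Proof.
move=> hx hy v0; apply/eqP; apply: contraNT v0 => xy.
by rewrite -hx -hy hprojK (negbTE xy).
Qed.

Lemma homog_neg x v : homog x v -> x < 0 -> v = 0.
Proof.
move=> /homogP hv x0; apply/ffunP => eps; rewrite [in RHS]ffunE; apply: hv.
by rewrite /degree; lia.
Qed.

Lemma hproj_eq0 v : (forall l : nat, hproj l%:Z v = 0) -> v = 0.
Proof.
move=> H; apply/ffunP => eps.
have /ffunP/(_ eps) := H (\sum_t nindex_of eps t)%N.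
by rewrite !ffunE eqxx.
Qed.

Lemma homogZ x a v : homog x v -> homog x (a *: v).
Proof. by rewrite /homog linearZ /= => ->. Qed.

Lemma tensor_scaleE a v eps : (a *: v) eps = a * v eps.
Proof. by rewrite ffunE. Qed.

Lemma memv_Vnl l v : reflect (homog l%:Z v) (v \in Vnl R r n l).
Proof.
have deg eps : (degree (nindex_of eps) == l%:Z) = ((\sum_(t < n) eps t)%N == l).
  rewrite /degree; congr (_ == _ :> nat).
  by apply: eq_bigr => t _; rewrite ffunE.
apply: (iffP idP) => [/memv_sumP[vs vsP ->]|hv].
  rewrite /homog linear_sum; apply: eq_bigr => eps eps_l.
  have /vlineP[a ->] := vsP eps eps_l; rewrite linearZ /=; congr (_ *: _).
  apply/ffunP => e; rewrite !ffunE; case: (eqVneq e eps) => [->|].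
    by rewrite deg eps_l.
  by rewrite if_same.
have -> : v = \sum_(eps : mindex r n | (\sum_(t < n) eps t == l)%N)
    v eps *: basis_vec R eps.
  apply/ffunP => e; rewrite sum_ffunE -{1}hv ffunE deg.
  rewrite (eq_bigr (fun e' => if e' == e then v e else 0)) => [|e' _]; last first.
    rewrite tensor_scaleE ffunE.
    case: (eqVneq e' e) => [->|ne]; first by rewrite mulr1.
    by rewrite mulr0.
  rewrite -big_mkcondr; case: ifP => el.
    rewrite (big_pred1 e) // => e' /=.
    by case: (eqVneq e' e) => [->|_]; rewrite ?el ?andbF.
  rewrite big_pred0 // => e'.
  by case: (eqVneq e' e) => [->|_]; rewrite ?el ?andbF.
by apply: memv_sumr => eps _; rewrite memvZ // memv_line.
Qed.

End Degrees.

(** * Relations in the tensor power *)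

Section Relations.
Variables (R : realType) (r n : nat).
Hypothesis hr : (2 <= r)%N.
Local Notation C := R[i].
Local Notation h := (qhalf R r).
Local Notation q := (qq R r).
Local Notation "[ x ]" := (qint R r x).
Local Notation T := (tensor R r n).
Local Notation tE := (tensE R r n).
Local Notation tF := (tensF R r n).
Implicit Types (eta : nindex n) (u v : T) (eps : mindex r n) (x y : int).

Definition kweight x : int := (n * (r - 1))%N%:Z - 2 * x.
Local Notation M := kweight.

Lemma tensor_op_diag (A : 'M[C]_r) (g : nat -> int) x v :
    (forall a b : 'I_r, A a b = h ^ g a *+ (a == b)) ->
    (forall eps, v eps != 0 -> \sum_t g (eps t) = x) ->
  tensor_op (fun=> A) v = h ^ x *: v.
Proof.
move=> HA Hg; apply/ffunP => eps; rewrite tensor_scaleE.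
rewrite (@tensor_opE _ _ _ _ _ _ (fun t => h ^ g (eps t)) (nindex_of eps)).
  rewrite coordE; case: (eqVneq (v eps) 0) => [->|ve]; first by rewrite !mulr0.
  rewrite -(Hg _ ve); congr (_ * _); rewrite (big_morph (exprz h) (id1 := 1) (op1 := *%R)) //.
  by move=> a b; rewrite expfzDr ?qhalf_neq0.
by move=> t y; rewrite HA ffunE -val_eqE eq_sym.
Qed.

Lemma sum_weight eps :
  \sum_t ((r - 1)%N%:Z - (2 * eps t)%N%:Z) = M (degree (nindex_of eps)).
Proof.
rewrite sumrB sumr_const card_ord /M /degree; congr (_ - _).
  by rewrite PoszM -mulr_natl natz.
rewrite (big_morph Posz PoszD (erefl (Posz 0))) mulr_sumr.
by apply: eq_bigr => t _; rewrite ffunE PoszM.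
Qed.

Lemma tensk_homog x v : homog x v -> tensk R r n v = h ^ M x *: v.
Proof.
move/homogP => hv; apply: (@tensor_op_diag _ (fun a => (r - 1)%N%:Z - (2 * a)%N%:Z)).
  by move=> a b; rewrite mxE; case: eqP => [->|].
move=> eps ve; rewrite sum_weight; congr (M _).
by apply/eqP; apply: contraNT ve => /hv ->.
Qed.

Lemma tenskV_homog x v : homog x v -> tenskV R r n v = h ^ (- M x) *: v.
Proof.
move/homogP => hv; apply: (@tensor_op_diag _ (fun a => - ((r - 1)%N%:Z - (2 * a)%N%:Z))).
  by move=> a b; rewrite mxE; case: eqP => [->|].
move=> eps ve; rewrite sumrN sum_weight; congr (- M _).
by apply/eqP; apply: contraNT ve => /hv ->.
Qed.

(** Comparing eigenvalues gives [h^(M x) = alpha h^m]; since [alpha^4 = 1], fourth powers give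
    [h^(4(m - M x)) = 1]. *)
Lemma weight_congr x v (alpha : C) (m : nat) :
    homog x v -> v != 0 -> alpha \in fourth_roots R ->
    tensk R r n v = (alpha * h ^+ m) *: v ->
  (r %| m%:Z - M x)%Z.
Proof.
move=> hv v0 ha; rewrite (tensk_homog hv) => /esym/eqP.
rewrite -subr_eq0 -scalerBl scaler_eq0 (negbTE v0) orbF subr_eq0 => /eqP e.
rewrite -(qhalf_exp_eq1 R hr).
have a4 : alpha ^+ 4 = 1.
  move: ha; rewrite !inE => /or4P[] /eqP ->; rewrite ?expr1n //; first by ring.
    by rewrite (exprM 'i 2 2) sqrCi; ring.
  by rewrite (exprM (- 'i) 2 2) sqrrN sqrCi; ring.
have := congr1 (fun z => z ^ 4%:Z) e.
rewrite /= expfzMl -(exprnP alpha 4) a4 mul1r (exprnP h m) !exprz_exp => e4.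
rewrite mulrBr expfzDr ?qhalf_neq0 // -invr_expz (mulrC 4 m%:Z) (mulrC 4 (M x)) e4.
by rewrite mulfV // expfz_neq0 ?qhalf_neq0.
Qed.

Hypothesis HD : is_Dmodule r (tensD R r n).

Lemma EF_comm x v : homog x v -> tE (tF v) = tF (tE v) + [M x] *: v.
Proof.
move=> hv; apply/eqP; rewrite addrC -subr_eq; apply/eqP.
have /= -> := Drel_EF HD v.
rewrite (tensk_homog hv) (tenskV_homog hv).
rewrite (tensk_homog (homogZ _ hv)) (tenskV_homog (homogZ _ hv)).
rewrite !scalerA -scalerBl scalerA -!expr2.
by rewrite !qhalf_sqrz /qint mulrC.
Qed.

Lemma E_iterF x v t : homog x v ->
  tE (iter t tF v) = iter t tF (tE v)
    + ([t] * [M x - t%:Z + 1]) *: iter t.-1 tF v.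
Proof.
move=> hv; elim: t => [|t IH] /=.
  by rewrite (_ : [0%N] = 0) ?mul0r ?scale0r ?addr0 //; apply/eqP; rewrite qint_eq0 ?dvdz0.
rewrite (EF_comm (homog_iterF hr t hv)) IH linearD /= -addrA; congr (_ + _).
have -> : [M (x + t%:Z)] = [M x - 2 * t%:Z] by congr [_]; rewrite /M; lia.
have -> : [t.+1] * [M x - t.+1%:Z + 1] =
    [t] * [M x - t%:Z + 1] + [M x - 2 * t%:Z].
  by rewrite qint_step_F //; congr ([_] * [_]); lia.
rewrite linearZ /= scalerDl; congr (_ + _).
(* At [t = 0] the predecessor [t.-1] is truncated, but the coefficient [[0]] removes that term. *)
case: t {IH} => [|t] //=.
by rewrite (_ : [0%N] = 0) ?mul0r ?scale0r //; apply/eqP; rewrite qint_eq0 ?dvdz0.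
Qed.

(** The term with [F E v] is kept, because the formula is applied to vectors that [E] need not kill:
    for the generator [w] it is [w^S], and for [w^S] it is 0. *)
Lemma F_iterE x v t : homog x v ->
  tF (iter t.+1 tE v) = iter t tE (tF (tE v))
    - ([t] * [M x + t%:Z + 1]) *: iter t tE v.
Proof.
move=> hv; elim: t => [|t IH].
  by rewrite (_ : [0%N] = 0) ?mul0r ?scale0r ?subr0 //; apply/eqP; rewrite qint_eq0 ?dvdz0.
have /= e := EF_comm (homog_iterE hr t.+1 hv).
have -> : tF (iter t.+2 tE v) = tE (tF (iter t.+1 tE v)) - [M (x - t.+1%:Z)] *: iter t.+1 tE v.
  by rewrite e addrK.
have -> : [t.+1] * [M x + t.+1%:Z + 1] =
    [t] * [M x + t%:Z + 1] + [M x + 2 * (t%:Z + 1)].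
  by rewrite qint_step_E //; congr ([_] * [_]); lia.
have -> : [M (x - t.+1%:Z)] = [M x + 2 * (t%:Z + 1)] by congr [_]; rewrite /M; lia.
by rewrite IH linearB linearZ /= -addrA -opprD -scalerDl.
Qed.

Lemma iterE_iterF x v t : homog x v -> tE v = 0 ->
  iter t tE (iter t tF v) = (\prod_(i < t) ([i.+1] * [M x - i%:Z])) *: v.
Proof.
move=> hv Ev; elim: t => [|t IH]; first by rewrite big_ord0 scale1r.
rewrite iterSr (E_iterF t.+1 hv) Ev iter_lfun0 add0r iter_lfunZ /= IH scalerA.
rewrite big_ord_recr /= mulrC; congr (_ *: _); congr (_ * (_ * [_])); lia.
Qed.

Lemma tensE_nil v : iter r tE v = 0. Proof. exact: (Drel_Er HD). Qed.
Lemma tensF_nil v : iter r tF v = 0. Proof. exact: (Drel_Fr HD). Qed.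

Hypothesis hn : (2 <= n)%N.

Lemma ker_tensE_homog x v : homog x v -> tE v = 0 ->
  exists2 z, homog (x + (r - 1)%N%:Z) z & v = iter (r - 1) tE z.
Proof.
move=> hv Ev; have o : (n - 1 < n)%N by lia.
have [|z e] := @ker_tensE_sub_im R r n hr (Ordinal o) _ tensE_nil v Ev.
  by rewrite /=; lia.
exists (hproj (x + (r - 1)%N%:Z) z); first exact: homog_hproj.
by rewrite iter_tensE_hproj // addrK -e hv.
Qed.

Lemma ker_tensF_homog x v : homog x v -> tF v = 0 ->
  exists2 z, homog (x - (r - 1)%N%:Z) z & v = iter (r - 1) tF z.
Proof.
move=> hv Fv; have o : (0 < n)%N by lia.
have [//|z e] := @ker_tensF_sub_im R r n hr (Ordinal o) _ tensF_nil v Fv.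
exists (hproj (x - (r - 1)%N%:Z) z); first exact: homog_hproj.
by rewrite iter_tensF_hproj // subrK -e hv.
Qed.

Lemma ker_tensF_low x v : homog x v -> x < (r - 1)%N%:Z -> tF v = 0 -> v = 0.
Proof.
move=> hv xr Fv; have [z hz ->] := ker_tensF_homog hv Fv.
by rewrite (homog_neg hr hz) ?iter_lfun0 // subr_lt0.
Qed.

End Relations.

(** * The given decomposition *)

Lemma lmod_relD (K : fieldType) (W : vectType K) (a : K)
    (x x' y y' z z' t t' : W) :
  x - y = a *: (z - t) -> x' - y' = a *: (z' - t') ->
  x + x' - (y + y') = a *: (z + z' - (t + t')).
Proof. by move=> e e'; rewrite !opprD !(addrACA _ _ (- _)) e e' -scalerDr. Qed.

Section Decomposition.
Variables (R : realType) (r n : nat).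
Hypothesis hr : (2 <= r)%N.
Local Notation C := R[i].
Local Notation T := (tensor R r n).
Local Notation tE := (tensE R r n).
Local Notation tF := (tensF R r n).
Local Notation D := (tensD R r n).
Implicit Types (u v : T) (x y : int).

Lemma graded_hproj (U : {vspace T}) x u : graded U -> u \in U -> hproj x u \in U.
Proof.
move=> gU; rewrite {1}gU => /memv_sumP[us usP ->].
rewrite linear_sum; apply: memv_suml => l _.
have /memv_capP[uU /memv_Vnl ul] := usP l isT.
rewrite -[X in X \in U]/(hproj x (us l)); suff -> : hproj x (us l) = if x == l then us l else 0.
  by case: (x == l); rewrite ?mem0v.
by rewrite -[in LHS]ul hprojK ul.
Qed.

Lemma Dhom_iterE (M N : Daction R) (f : 'Hom(M, N)) t m :
  Dhom f -> iter t (opE N) (f m) = f (iter t (opE M) m).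
Proof. by case=> fE _ _ _; elim: t => //= t ->; rewrite fE. Qed.

Lemma Dhom_iterF (M N : Daction R) (f : 'Hom(M, N)) t m :
  Dhom f -> iter t (opF N) (f m) = f (iter t (opF M) m).
Proof. by case=> _ fF _ _; elim: t => //= t ->; rewrite fF. Qed.

Lemma Dhom_iterk (M N : Daction R) (f : 'Hom(M, N)) t m :
  Dhom f -> iter t (opk N) (f m) = f (iter t (opk M) m).
Proof. by case=> _ _ fk _; elim: t => //= t ->; rewrite fk. Qed.

Lemma Diso_sub_Dsub (M : Daction R) (U : {vspace T}) :
  @Diso_sub R M D U -> @Dsub R D U.
Proof.
move=> [f [[fE fF fk fV] _ <-]].
split; apply/subvP => y /memv_imgP[z /memv_imgP[m _ ->] ->].
- by rewrite -fE memv_img ?memvf.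
- by rewrite -fF memv_img ?memvf.
- by rewrite -fk memv_img ?memvf.
- by rewrite -fV memv_img ?memvf.
Qed.

Variable d : decomposition R r n.

Definition dec_index := ('I_(nC d) + 'I_(nP d))%type.

Definition dec_summand (k : dec_index) : {vspace T} :=
  match k with inl i => Csum i | inr i => Psum i end.

Lemma dec_summand_full : (\sum_k dec_summand k)%VS = fullv.
Proof. by rewrite big_sumType /= dec_full. Qed.

Lemma dec_summand_direct : directv (\sum_k dec_summand k)%VS.
Proof. by have := dec_direct d; rewrite !directvE /= !big_sumType. Qed.

Lemma dec_summand_graded k : graded (dec_summand k).
Proof. by case: k => i; [exact: dec_Cgraded|exact: dec_Pgraded]. Qed.

Lemma dec_summand_iso k : exists2 M : Daction R,
  is_Dmodule r M & @Diso_sub R M D (dec_summand k).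
Proof.
case: k => i.
  by have [M [[HM _ _ _] HU]] := dec_Ciso i; exists M.
by have [M [[S [_ [[HM _] _]]] HU]] := dec_Piso i; exists M.
Qed.

Lemma dec_summand_Dsub k : @Dsub R D (dec_summand k).
Proof. by have [M _ /Diso_sub_Dsub] := dec_summand_iso k. Qed.

Lemma dec_split v : exists2 us : dec_index -> T,
  (forall k, us k \in dec_summand k) & v = \sum_k us k.
Proof.
have : v \in (\sum_k dec_summand k)%VS by rewrite dec_summand_full memvf.
by case/memv_sumP => us usU ->; exists us => // k; apply: usU.
Qed.

Lemma dec_unique (us : dec_index -> T) :
  (forall k, us k \in dec_summand k) -> \sum_k us k = 0 -> forall k, us k = 0.
Proof.
move=> usU us0 k.
by have /directv_sum_independent/(_ us) := dec_summand_direct; apply.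
Qed.

Lemma dec_unique2 (us vs : dec_index -> T) :
  (forall k, us k \in dec_summand k) -> (forall k, vs k \in dec_summand k) ->
  \sum_k us k = \sum_k vs k -> forall k, us k = vs k.
Proof.
move=> usU vsU e k; apply/eqP; rewrite -subr_eq0; apply/eqP.
apply: (@dec_unique (fun k => us k - vs k)) => [k'|]; first by rewrite memvB.
by rewrite sumrB e subrr.
Qed.

Lemma dec_additive_ind (Q : T -> Prop) :
    Q 0 -> (forall u v, Q u -> Q v -> Q (u + v)) ->
    (forall (M : Daction R) (f : 'Hom(M, D)) m, is_Dmodule r M -> Dhom f -> Q (f m)) ->
  forall v, Q v.
Proof.
move=> Q0 QD Qf v; have [us usU ->] := dec_split v.
apply: big_ind => // k _; have [M HM [f [fD _ fU]]] := dec_summand_iso k.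
by move: (usU k); rewrite -fU => /memv_imgP[m _ ->]; apply: Qf.
Qed.

(* The relations hold on each summand, which is isomorphic to a D-module, so
   they need not be checked on the iterated coproducts. *)
Lemma dec_is_Dmodule : is_Dmodule r D.
Proof.
split.
- apply: dec_additive_ind => [|u v eu ev|M f m HM fD].
  + by rewrite !linear0.
  + by rewrite !linearD /= eu ev.
  + by have [_ _ fk fV] := fD; rewrite -fk -fV (Drel_kV HM).
- apply: dec_additive_ind => [|u v eu ev|M f m HM fD].
  + by rewrite !linear0.
  + by rewrite !linearD /= eu ev.
  + by have [_ _ fk fV] := fD; rewrite -fV -fk (Drel_Vk HM).
- apply: dec_additive_ind => [|u v eu ev|M f m HM fD].
  + by rewrite iter_lfun0.
  + by rewrite iter_lfunD eu ev addr0.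
  + by rewrite (Dhom_iterE _ _ fD) (Drel_Er HM) linear0.
- apply: dec_additive_ind => [|u v eu ev|M f m HM fD].
  + by rewrite iter_lfun0.
  + by rewrite iter_lfunD eu ev addr0.
  + by rewrite (Dhom_iterF _ _ fD) (Drel_Fr HM) linear0.
- apply: dec_additive_ind => [|u v eu ev|M f m HM fD].
  + by rewrite iter_lfun0.
  + by rewrite iter_lfunD eu ev.
  + by rewrite (Dhom_iterk _ _ fD) (Drel_k4r HM).
- apply: dec_additive_ind => [|u v eu ev|M f m HM fD].
  + by rewrite !linear0.
  + by rewrite !linearD /= eu ev.
  + by have [fE _ fk _] := fD; rewrite -fk -!fE -!fk (Drel_kE HM) linearZ.
- apply: dec_additive_ind => [|u v eu ev|M f m HM fD].
  + by rewrite !linear0.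
  + by rewrite !linearD /= eu ev.
  + by have [_ fF fk _] := fD; rewrite -fk -!fF -!fk (Drel_kF HM) linearZ.
- apply: dec_additive_ind => [|u v eu ev|M f m HM fD].
  + by rewrite !(linear0, subrr, scaler0).
  + have L (f g : 'End(D)) : f (g (u + v)) = f (g u) + f (g v).
      by rewrite !linearD.
    rewrite (L (opE D)) (L (opF D)) (L (opk D)) (L (opkV D)).
    exact (lmod_relD eu ev).
  + have [fE fF fk fV] := fD.
    rewrite -fF -!fE -fF -!fk -!fV.
    by rewrite -linearB (Drel_EF HM) linearZ linearB.
Qed.

Lemma dec_split_tensE (us : dec_index -> T) :
  (forall k, us k \in dec_summand k) -> tE (\sum_k us k) = 0 ->
  forall k, tE (us k) = 0.
Proof.
rewrite linear_sum => usU; apply: dec_unique => k.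
by have [EU _ _ _] := dec_summand_Dsub k; apply: (subvP EU); apply: memv_img.
Qed.

Lemma dec_split_homog x (us : dec_index -> T) :
  (forall k, us k \in dec_summand k) -> homog x (\sum_k us k) ->
  forall k, homog x (us k).
Proof.
rewrite /homog linear_sum => usU; apply: dec_unique2 => // k.
by apply: graded_hproj => //; apply: dec_summand_graded.
Qed.

Lemma dec_summand_tensE k u : u \in dec_summand k -> tE u \in dec_summand k.
Proof.
by move=> uU; have [EU _ _ _] := dec_summand_Dsub k; apply/(subvP EU)/memv_img.
Qed.

Lemma dec_summand_tensF k u : u \in dec_summand k -> tF u \in dec_summand k.
Proof.
by move=> uU; have [_ FU _ _] := dec_summand_Dsub k; apply/(subvP FU)/memv_img.
Qed.

(** Split a preimage [z] along the decomposition. As [f] preserves every summand, uniqueness of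
    components shows that the component of [z] in summand [k] is already a preimage of [u]. *)
Lemma dec_summand_iter_im (f : 'End(T)) t k u :
    (forall k u, u \in dec_summand k -> f u \in dec_summand k) ->
    u \in dec_summand k -> (exists z, u = iter t f z) ->
  exists2 z, z \in dec_summand k & u = iter t f z.
Proof.
move=> fU uU [z ez]; have [zs zsU e] := dec_split z.
exists (zs k) => //; pose us k' := if k' == k then u else 0.
have <- : us k = u by rewrite /us eqxx.
apply: (@dec_unique2 us (fun k => iter t f (zs k))) => [k'|k'|].
- by rewrite /us; case: eqP => [->|]; rewrite ?mem0v.
- by apply: iter_lfun_mem => // v; apply: fU.
- rewrite -iter_lfun_sum -e -ez (bigD1 k) //= /us eqxx big1 ?addr0 //.
  by move=> k' /negbTE ->.
Qed.

Hypothesis hn : (2 <= n)%N.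

Lemma dec_summand_ker_tensE k x u :
    u \in dec_summand k -> homog x u -> tE u = 0 ->
  exists z, [/\ z \in dec_summand k, homog (x + (r - 1)%N%:Z) z
    & u = iter (r - 1) tE z].
Proof.
move=> uU hu Eu; have [z _ ez] := ker_tensE_homog hr dec_is_Dmodule hn hu Eu.
have [|z' z'U ez'] := dec_summand_iter_im dec_summand_tensE uU (t := (r - 1)%N).
  by exists z.
exists (hproj (x + (r - 1)%N%:Z) z'); split; last 1 first.
- by rewrite iter_tensE_hproj // addrK -ez' hu.
- by apply: graded_hproj => //; apply: dec_summand_graded.
- exact: homog_hproj.
Qed.

Lemma dec_summand_ker_tensF k x u :
    u \in dec_summand k -> homog x u -> tF u = 0 ->
  exists z, [/\ z \in dec_summand k, homog (x - (r - 1)%N%:Z) z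
    & u = iter (r - 1) tF z].
Proof.
move=> uU hu Fu; have [z _ ez] := ker_tensF_homog hr dec_is_Dmodule hn hu Fu.
have [|z' z'U ez'] := dec_summand_iter_im dec_summand_tensF uU (t := (r - 1)%N).
  by exists z.
exists (hproj (x - (r - 1)%N%:Z) z'); split; last 1 first.
- by rewrite iter_tensF_hproj // subrK -ez' hu.
- by apply: graded_hproj => //; apply: dec_summand_graded.
- exact: homog_hproj.
Qed.

End Decomposition.

(** * Simple summands *)

Section SpannedSubmodules.
Variables (R : realType) (r n : nat).
Hypothesis hr : (2 <= r)%N.
Local Notation C := R[i].
Local Notation T := (tensor R r n).
Local Notation tE := (tensE R r n).
Local Notation tF := (tensF R r n).
Local Notation D := (tensD R r n).
Local Notation M := (kweight r n).
Local Notation "[ x ]" := (qint R r x).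
Implicit Types (u v : T) (x y : int).

Section Span.
Variables (I : finType) (g : I -> T) (dg : I -> int).
Hypothesis hg : forall i, homog (dg i) (g i).
Let N := (\sum_i <[g i]>)%VS.

Lemma mem_gen i : g i \in N.
Proof. by rewrite memvE; apply: (sumv_sup i). Qed.

(** Homogeneous generators are eigenvectors of [k] and [k^-1], so only [E] and [F] have to be
    tested. *)
Lemma span_Dsub :
  (forall i, tE (g i) \in N) -> (forall i, tF (g i) \in N) -> @Dsub R D N.
Proof.
have stab (f : 'End(T)) : (forall i, f (g i) \in N) -> (f @: N <= N)%VS.
  move=> fN; apply/subvP => y /memv_imgP[z /memv_sumP[zs zsP ->] ->].
  rewrite linear_sum; apply: memv_suml => i _.
  by have /vlineP[a ->] := zsP i isT; rewrite linearZ /= memvZ ?fN.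
move=> EN FN; split; apply: stab => // i.
  by have /= -> := tensk_homog hr (hg i); rewrite memvZ // mem_gen.
by have /= -> := tenskV_homog hr (hg i); rewrite memvZ // mem_gen.
Qed.

Lemma span_homog x u :
  u \in N -> homog x u -> u \in (\sum_(i | dg i == x) <[g i]>)%VS.
Proof.
move=> /memv_sumP[us usP ->] <-; rewrite linear_sum.
rewrite [X in X \in _](_ : _ = \sum_(i | dg i == x) us i).
  by apply: memv_sumr => i _; apply: usP.
rewrite [RHS]big_mkcond; apply: eq_bigr => i _.
have /vlineP[a ->] := usP i isT.
rewrite linearZ /= -[in LHS](hg i) hprojK (hg i) eq_sym.
by case: (dg i == x); rewrite ?scaler0.
Qed.
End Span.

Lemma Diso_sub_simple (A : Daction R) (U N : {vspace T}) :
  Dsimple A -> @Diso_sub R A D U -> @Dsub R D N -> (N <= U)%VS ->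
  N = 0%VS \/ N = U.
Proof.
move=> [_ simA] [f [[fE fF fk fV] _ fU]] [EN FN kN VN] NU.
have fN : (f @: (f @^-1: N) = N)%VS by rewrite lpreimK // fU.
have stab (a : 'End(A)) (b : 'End(T)) : (forall m, f (a m) = b (f m)) ->
    (b @: N <= N)%VS -> (a @: (f @^-1: N) <= f @^-1: N)%VS.
  move=> fab bN; apply/subvP => y /memv_imgP[z zN ->].
  rewrite -memv_preim fab; apply: (subvP bN); apply: memv_img.
  by rewrite memv_preim.
have [|N0|NT] := simA (f @^-1: N)%VS.
- by split; [exact: stab fE EN|exact: stab fF FN|exact: stab fk kN|exact: stab fV VN].
- by left; rewrite -fN N0 limg0.
- by right; rewrite -fN NT fU.
Qed.

Hypothesis HD : is_Dmodule r D.

(** * The submodule generated by a highest weight vector *)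

Section HighestWeight.
Variables (x : int) (v : T).
Hypotheses (hv : homog x v) (Ev : tE v = 0).

Definition hw_module := (\sum_(t < r) <[iter t tF v]>)%VS.

Let mem_hw t : iter t tF v \in hw_module.
Proof.
case: (ltnP t r) => [tr|rt]; first exact: (mem_gen (fun t : 'I_r => _) (Ordinal tr)).
by rewrite -(subnK rt) iterD (tensF_nil HD) iter_lfun0 mem0v.
Qed.

Lemma hw_Dsub : @Dsub R D hw_module.
Proof.
apply: (@span_Dsub _ _ (fun t : 'I_r => x + t%:Z)) => t.
- exact: homog_iterF.
- by rewrite (E_iterF hr HD t hv) Ev iter_lfun0 add0r memvZ ?mem_hw.
- exact: (mem_hw t.+1).
Qed.

Lemma hw_homog y u : u \in hw_module -> homog y u -> u != 0 -> x <= y.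
Proof.
move=> uN hu; apply: contraNT; rewrite -ltNge => yx.
have := span_homog (dg := fun t : 'I_r => x + t%:Z) _ uN hu.
rewrite big_pred0; last by move=> t; lia.
by rewrite memv0; apply=> t; apply: homog_iterF.
Qed.

Lemma hw_top u : u \in hw_module -> homog x u -> u \in <[v]>%VS.
Proof.
move=> uN hu.
have := span_homog (dg := fun t : 'I_r => x + t%:Z) _ uN hu.
rewrite (big_pred1 (Ordinal (ltnW hr))) => [|t]; last first.
  by rewrite /= -val_eqE /=; lia.
by apply=> t; apply: homog_iterF.
Qed.
End HighestWeight.

(** By simplicity every nonzero homogeneous vector of [U] killed by [E] generates [U] under [F]. As
    [F] raises the degree, such a vector spans the part of lowest degree, so any two of them have
    equal degree and are proportional. *)
Lemma simple_hw (A : Daction R) (U : {vspace T}) (l : int) v u0 :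
    Dsimple A -> @Diso_sub R A D U -> v \in U -> homog l v -> tE v = 0 -> v != 0 ->
    u0 \in U -> u0 != 0 -> tE u0 = 0 -> (forall y u, u \in U -> hproj y u \in U) ->
  homog l u0 /\ v \in <[u0]>%VS.
Proof.
move=> simA isoU vU hv Ev v0 u0U u00 Eu0 gU.
have stab t u : u \in U -> iter t tF u \in U.
  move=> uU; apply: iter_lfun_mem => // z zU.
  have [_ FU _ _] := Diso_sub_Dsub isoU.
  by apply: (subvP FU); apply: memv_img.
have eqU y z : homog y z -> tE z = 0 -> z \in U -> z != 0 -> U = hw_module z.
  move=> hz Ez zU z0.
  have sub : (hw_module z <= U)%VS.
    by apply/subv_sumP => t _; rewrite -memvE stab.
  case: (Diso_sub_simple simA isoU (hw_Dsub hz Ez) sub) => // N0.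
  case/negP: z0; rewrite -memv0 -N0.
  exact: (mem_gen (fun t : 'I_r => iter t tF z) (Ordinal (ltnW hr))).
(* [u0] is not assumed homogeneous, but each of its components is again killed by [E]; a nonzero one
   has lowest degree in [U], as [v] has, so its degree is [l]. *)
have hu0 : homog l u0.
  apply/eqP; rewrite -subr_eq0; apply/eqP; apply: hproj_eq0 => y.
  rewrite linearB /= hprojK; case: (eqVneq (y%:Z) l) => [->|yl]; first by rewrite subrr.
  rewrite sub0r; apply/eqP; rewrite oppr_eq0; apply: contraNT yl => p0.
  have Ep : tE (hproj y u0) = 0 by rewrite tensE_hproj // Eu0 linear0.
  have pU := gU y _ u0U; rewrite eq_le; apply/andP; split.
    apply: (@hw_homog _ _ (homog_hproj y u0) _ v) => //.
    by rewrite -(eqU _ _ (homog_hproj y u0)).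
  by apply: (@hw_homog _ _ hv _ (hproj y u0)); rewrite -?(eqU _ _ hv) //; apply: homog_hproj.
split=> //; have := @hw_top _ _ hu0 v.
by rewrite -(eqU _ _ hu0) //; apply.
Qed.

End SpannedSubmodules.

(** * Projective summands *)

Section ProjectiveSummand.
Variables (R : realType) (r n : nat).
Hypothesis hr : (2 <= r)%N.
Local Notation C := R[i].
Local Notation T := (tensor R r n).
Local Notation tE := (tensE R r n).
Local Notation tF := (tensF R r n).
Local Notation D := (tensD R r n).
Local Notation M := (kweight r n).
Local Notation "[ x ]" := (qint R r x).
Implicit Types (u v : T) (x y : int).

Hypothesis HD : is_Dmodule r D.
Variables (U : {vspace T}) (w : T) (d : int) (m : nat).
Hypotheses (wU : w \in U) (w_neq0 : w != 0) (hw : homog d w).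
Hypothesis genU : forall N : {vspace T}, @Dsub R D N -> w \in N -> (U <= N)%VS.
Hypothesis FEFEw : tF (tE (tF (tE w))) = 0.
Hypotheses (hm : (m <= r - 2)%N) (hmd : (r %| m%:Z - M d)%Z).
Hypotheses (UE : forall u, u \in U -> tE u \in U)
           (UF : forall u, u \in U -> tF u \in U).
Hypothesis kerUE : forall x u, u \in U -> homog x u -> tE u = 0 ->
  exists z, [/\ z \in U, homog (x + (r - 1)%N%:Z) z & u = iter (r - 1) tE z].
Hypothesis kerUF : forall x u, u \in U -> homog x u -> tF u = 0 ->
  exists z, [/\ z \in U, homog (x - (r - 1)%N%:Z) z & u = iter (r - 1) tF z].

Let wS := tF (tE w).

Let hwS : homog d wS.
Proof. by have := homog_tensF hr (homog_tensE hr hw); rewrite subrK. Qed.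

(** The vectors [E^t w], [F^t w], [E^t w^S], [F^t w^S] with [t < r]. Their span is a submodule:
    moving [E] past [F^t] or [F] past [E^t] only produces a neighbour in the same family and [F E],
    which sends [w] to [w^S] and [w^S] to 0. Hence it contains [U]. *)
Let gen (i : 'I_r * bool * bool) : T :=
  iter i.1.1 (if i.1.2 then tE else tF) (if i.2 then w else wS).
Let dgen (i : 'I_r * bool * bool) : int :=
  if i.1.2 then d - i.1.1%:Z else d + i.1.1%:Z.

Let hgen i : homog (dgen i) (gen i).
Proof.
case: i => [[t b] c]; rewrite /gen /dgen /=.
by case: b c => -[]; (apply: homog_iterE || apply: homog_iterF).
Qed.

Let N := (\sum_i <[gen i]>)%VS.

Let mem_gen_iter t b c :
  iter t (if b then tE else tF) (if c then w else wS) \in N.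
Proof.
case: (ltnP t r) => [tr|rt]; first exact: (mem_gen gen (Ordinal tr, b, c)).
rewrite -(subnK rt) iterD; case: b.
  by rewrite (tensE_nil HD) iter_lfun0 mem0v.
by rewrite (tensF_nil HD) iter_lfun0 mem0v.
Qed.

Let genFE c : tF (tE (if c then w else wS)) = if c then wS else 0.
Proof. by case: c; rewrite // /wS FEFEw. Qed.

Let U_sub_gen : (U <= N)%VS.
Proof.
apply: genU; last exact: (mem_gen_iter 0 true true).
have hc c : homog d (if c then w else wS) by case: c.
apply: (span_Dsub hr hgen) => -[[t b] c]; rewrite /gen /=.
  case: b; first exact: (mem_gen_iter t.+1 true c).
  rewrite (E_iterF hr HD t (hc c)); apply: memvD; last first.
    exact: memvZ (mem_gen_iter t.-1 false c).
  case: t => -[|t] tr /=; first exact: (mem_gen_iter 1 true c).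
  rewrite -iterS iterSr genFE; case: c; last by rewrite iter_lfun0 mem0v.
  exact: (mem_gen_iter t false false).
case: b; last exact: (mem_gen_iter t.+1 false c).
case: t => -[|t] tr; first exact: (mem_gen_iter 1 false c).
rewrite -[iter (Ordinal tr) _ _]/(iter t.+1 _ _) (F_iterE hr HD t (hc c)).
apply: memvB; last exact: memvZ (mem_gen_iter t true c).
rewrite genFE; case: c; last by rewrite iter_lfun0 mem0v.
exact: (mem_gen_iter t true false).
Qed.

Let U_homog x u : u \in U -> homog x u -> u \in (\sum_(i | dgen i == x) <[gen i]>)%VS.
Proof. by move=> /(subvP U_sub_gen) uN hu; apply: (span_homog hgen). Qed.

Let U_high x u : u \in U -> homog x u -> d + (r - 1)%N%:Z < x -> u = 0.
Proof.
move=> uU hu xd; apply/eqP; rewrite -memv0.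
have := U_homog uU hu; rewrite big_pred0 // => -[[[t tr] b] c].
by rewrite /dgen /=; case: b; lia.
Qed.

Let U_low x u : u \in U -> homog x u -> x < d - (r - 1)%N%:Z -> u = 0.
Proof.
move=> uU hu xd; apply/eqP; rewrite -memv0.
have := U_homog uU hu; rewrite big_pred0 // => -[[[t tr] b] c].
by rewrite /dgen /=; case: b; lia.
Qed.

Let kerE_high x u : u \in U -> homog x u -> d < x -> tE u = 0 -> u = 0.
Proof.
move=> uU hu dx Eu; have [z [zU hz ->]] := kerUE uU hu Eu.
by rewrite (U_high zU hz) ?iter_lfun0 //; lia.
Qed.

Let kerF_low x u : u \in U -> homog x u -> x < d -> tF u = 0 -> u = 0.
Proof.
move=> uU hu xd Fu; have [z [zU hz ->]] := kerUF uU hu Fu.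
by rewrite (U_low zU hz) ?iter_lfun0 //; lia.
Qed.

Let wSU : wS \in U.
Proof. exact: UF (UE wU). Qed.

(** [E w^S] has degree [d - 1] and is killed by [F] because [(FE)^2 w = 0]; below degree [d] this
    forces it to vanish. *)
Lemma tensE_wS : tE wS = 0.
Proof.
apply: (@kerF_low (d - 1)); [exact: UE|exact: homog_tensE|lia|exact: FEFEw].
Qed.

Let dvd_small (k : nat) : (r %| k%:Z)%Z -> (0 < k < r)%N -> False.
Proof. by rewrite dvdzE /= => dv /andP[k0 kr]; move: (dvdn_leq k0 dv); lia. Qed.

(** As [M d] is congruent to [m], the second factor vanishes exactly when [r] divides [m + t + 1], a
    number strictly between 0 and [2r]. This is what places [w^R] at the exponent [r - 1 - m]. *)
Let coefE_eq0 (t : nat) : (0 < t < r)%N ->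
  ([t] * [M d + t%:Z + 1] == 0) = (t == r - 1 - m)%N.
Proof.
move=> tr; rewrite mulf_eq0 !qint_eq0 //.
have -> : (r %| t%:Z)%Z = false by apply/negbTE/negP => /dvd_small; apply.
rewrite (_ : M d + t%:Z + 1 = (m + t + 1)%N%:Z - (m%:Z - M d)); last by lia.
rewrite /= (rpredBr _ hmd); apply/idP/eqP => [dv|->].
  have : (r %| (m + t + 1)%N%:Z - r%:Z)%Z by rewrite rpredBr ?dvdzz.
  case: (ltngtP (m + t + 1) r) => [lt|gt|e _].
  - by case/dvd_small: dv; rewrite lt addn1.
  - by rewrite subzn ?(ltnW gt) // => /dvd_small []; move: gt tr hm hr; clear; lia.
  - by move: e; clear; lia.
by rewrite (_ : (m + _ + 1)%N = r) ?dvdzz //; move: hm hr; clear; lia.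
Qed.

(** If [w^S = 0], then [E w], killed by [F] in degree [d - 1], is 0. Then [E F^(m+1) w] is a
    multiple of [[M d - m] = 0], so [F^(m+1) w], killed by [E] above degree [d], is 0 as well. This
    contradicts freeness over [E]. *)
Lemma wS_neq0 : wS != 0.
Proof.
apply/negP => /eqP wS0.
have Ew : tE w = 0.
  apply: (@kerF_low (d - 1)); [exact: UE|exact: homog_tensE|lia|exact: wS0].
have Fm0 : iter m.+1 tF w = 0.
  apply: (@kerE_high (d + m.+1%:Z)); [|exact: homog_iterF|lia|].
    by apply: iter_lfun_mem.
  rewrite (E_iterF hr HD m.+1 hw) Ew iter_lfun0 add0r.
  have -> : [M d - m.+1%:Z + 1] = 0.
    apply/eqP; rewrite qint_eq0 //.
    by rewrite (_ : _ + 1 = - (m%:Z - M d)) ?rpredN //; lia.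
  by rewrite mulr0 scale0r.
(* Here [w = E^(r-1) z] with [z] of degree [d + (r - 1)]. Among the generators only [F^(r-1) w] and
   [F^(r-1) w^S] have that degree, and both are 0, so [z = 0]. *)
have [z [zU hz wz]] := kerUE wU hw Ew.
have z0 : z \in 0%VS.
  apply: (subvP _ _ (U_homog zU hz)); apply/subv_sumP => -[[[t tr] b] c].
  rewrite /dgen /gen /= => ht; apply/subvP => y /vlineP[a ->].
  case: b ht => ht; first by move: ht hr; clear; lia.
  have -> : t = (r - 1)%N by move: ht hr; clear; lia.
  rewrite -(@subnK m.+1 (r - 1)); last by move: hm hr; clear; lia.
  rewrite iterD; case: c; last by rewrite wS0 !iter_lfun0 scaler0 mem0v.
  by rewrite Fm0 iter_lfun0 scaler0 mem0v.
by case/negP: w_neq0; rewrite wz (eqP (_ : z == 0)) ?iter_lfun0 // -memv0.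
Qed.

Let F_iterE_w t : (0 < t)%N ->
  tF (iter t.+1 tE w) = - ([t] * [M d + t%:Z + 1]) *: iter t tE w.
Proof.
case: t => // t _; rewrite (F_iterE hr HD t.+1 hw) iterSr -/wS tensE_wS.
by rewrite iter_lfun0 sub0r scaleNr.
Qed.

(** [F] maps [E^(t+1) w] to a nonzero multiple of [E^t w] for [0 < t < r - 1 - m], and [E w] to
    [w^S]. *)
Lemma iterE_w_neq0 t : (t <= r - 1 - m)%N -> iter t tE w != 0.
Proof.
elim: t => // -[_ _|t IH tm].
  by apply/negP => /eqP Ew; case/negP: wS_neq0; rewrite /wS /= in Ew *; rewrite Ew linear0.
apply/negP => /eqP Ew; have := F_iterE_w (ltn0Sn t).
rewrite Ew linear0 => /esym/eqP; rewrite scaler_eq0 oppr_eq0 coefE_eq0; last first.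
  by move: tm hr; clear; lia.
by rewrite (negbTE (IH _)); move: tm; clear; lia.
Qed.

Let wR := iter (r - 1 - m) tE w.

(** At exponent [r - 1 - m] the coefficient vanishes, so [F] kills [E w^R], which lies below degree
    [d]. *)
Lemma tensE_wR : tE wR = 0.
Proof.
apply: (@kerF_low (d - (r - 1 - m).+1%:Z)); [|exact: homog_iterE|lia|].
  by apply: UE; apply: iter_lfun_mem.
rewrite /wR -iterS F_iterE_w; last by lia.
have /eqP -> : [(r - 1 - m)%N] * [M d + (r - 1 - m)%N%:Z + 1] == 0.
  by rewrite coefE_eq0 //; lia.
by rewrite oppr0 scale0r.
Qed.

Lemma iterF_wR : exists2 c : C, c != 0 & iter (r - 1 - m) tF wR = c *: wS.
Proof.
(* The exponent is positive because [m <= r - 2]; the induction starts from [F E w = w^S] with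
   constant 1. *)
have [t et] : exists t, (r - 1 - m)%N = t.+1 by exists (r - 2 - m)%N; lia.
rewrite /wR et; have : (t < r - 1 - m)%N by lia.
elim: t {et} => [|t IH] tm; first by exists 1; rewrite ?oner_neq0 ?scale1r.
have [|c c0 e] := IH _; first by lia.
exists (- ([t.+1] * [M d + t.+1%:Z + 1]) * c).
  by rewrite mulf_neq0 // oppr_eq0 coefE_eq0; move: tm; clear; lia.
by rewrite iterSr F_iterE_w // iter_lfunZ e scalerA.
Qed.

(** In degree [d - t] with [t > 0], [U] is at most the line of [E^t w], and applying [F] to
    [E^(t+1) w = 0] leaves only [t = r - 1 - m]. In degree [d], [F E] sends [a w + b w^S] to
    [a w^S], so [a = 0]. *)
Lemma summand_kerE x u : u \in U -> homog x u -> tE u = 0 -> u != 0 ->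
  (x = d /\ u \in <[wS]>%VS) \/
  (x = d - (r - 1 - m)%N%:Z /\ u \in <[wR]>%VS).
Proof.
move=> uU hu Eu u0; case: (ltgtP x d) => [xd|dx|xd].
- right; have [t xt] : exists t : nat, x = d - t%:Z.
    by exists `|d - x|%N; move: xd; clear; lia.
  have t0 : (0 < t)%N by move: xd; rewrite xt; clear; lia.
  have ut : u \in <[iter t tE w]>%VS.
    apply: (subvP _ _ (U_homog uU hu)); apply/subv_sumP => -[[[s sr] b] c].
    rewrite /dgen /gen /= => hs; have [-> st] : b = true /\ s = t.
      by case: b hs; rewrite xt; move: t0; clear; lia.
    rewrite st; case: c => //.
    by rewrite -(prednK t0) iterSr tensE_wS iter_lfun0 -memvE mem0v.
  have tr : (t < r)%N.
    rewrite ltnNge; apply/negP => rt; case/negP: u0.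
    by rewrite (U_low uU hu) // xt; move: rt hr; clear; lia.
  have [a ua] := vlineP _ _ ut; have a0 : a != 0.
    by apply: contraNneq u0 => a0; rewrite ua a0 scale0r.
  have wt0 : iter t tE w != 0.
    by apply: contraNneq u0 => wt0; rewrite ua wt0 scaler0.
  have /eqP : tE (iter t tE w) = 0.
    apply/eqP; move: Eu; rewrite ua linearZ /= => /eqP.
    by rewrite scaler_eq0 (negbTE a0).
  rewrite -iterS => /eqP /(congr1 tF); rewrite linear0 F_iterE_w // => /eqP.
  rewrite scaler_eq0 (negbTE wt0) orbF oppr_eq0 coefE_eq0; last by rewrite t0 tr.
  by move/eqP => et; rewrite xt /wR -et.
- by case/negP: u0; rewrite (kerE_high uU hu dx Eu).
left; split=> //; subst x.
have : u \in (<[w]> + <[wS]>)%VS.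
  apply: (subvP _ _ (U_homog uU hu)); apply/subv_sumP => -[[[s sr] b] c].
  rewrite /dgen /gen /= => hs; have -> : s = 0%N by case: b hs; clear; lia.
  by case: c; [exact: addvSl|exact: addvSr].
case/memv_addP => _ /vlineP[a ->] [_ /vlineP[b ->] ue].
move: Eu; rewrite ue linearD !linearZ /= tensE_wS scaler0 addr0.
move/(congr1 tF); rewrite linearZ linear0 /= -/wS => /eqP.
rewrite scaler_eq0 (negbTE wS_neq0) orbF => /eqP ->.
by rewrite scale0r add0r memvZ // memv_line.
Qed.

Lemma projective_summand :
  [/\ wS != 0 /\ tE wS = 0, wR != 0 /\ tE wR = 0,
      exists2 c : C, c != 0 & iter (r - 1 - m) tF wR = c *: wS &
      forall x u, u \in U -> homog x u -> tE u = 0 -> u != 0 ->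
        (x = d /\ u \in <[wS]>%VS) \/
        (x = d - (r - 1 - m)%N%:Z /\ u \in <[wR]>%VS)].
Proof.
split; [split|split| |].
- exact: wS_neq0.
- exact: tensE_wS.
- exact: iterE_w_neq0.
- exact: tensE_wR.
- exact: iterF_wR.
- exact: summand_kerE.
Qed.

End ProjectiveSummand.

(** * The R-matrix *)

(* The identities to which [sigma_tensE] and [sigma_tensF] reduce, coefficient by
   coefficient: [X = q^x], [Y = q^y], [A = q^a], [S = s^(x+y)], [Q = q^(2xy)],
   [t = q^(a(a-1)/2)], [b = {a+1}] and [s = q^(r-1) = -q^-1]. *)
Lemma R_identity_E (K : fieldType) (q X Y A S Q t P b : K) :
    q != 0 -> X != 0 -> Y != 0 -> A != 0 -> S != 0 ->
    b = q * A - (q * A)^-1 -> b != 0 ->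
  (S^-1 * Q * t * P) * (- q^-1 / (X / A) ^+ 2)
    + S^-1 * Q * (t * A) * (P * ((X / A - A / X) ^+ 2 / b))
  = (- q^-1 / Y ^+ 2) * ((- q^-1 * S)^-1 * (Q * Y ^+ 2) * (t * A)
      * ((q * X - (q * X)^-1) ^+ 2 / b * P))
    + (- q^-1 * S)^-1 * (Q * X ^+ 2) * t * P.
Proof.
move=> q0 X0 Y0 A0 S0 eb b0.
(* The one relation that is not mere rearrangement: [{x+1}^2 - {x-a}^2 = {a+1}{2x-a+1}]. *)
have e : (q * X - (q * X)^-1) ^+ 2 =
    (X / A - A / X) ^+ 2 + b * (q * X ^+ 2 / A - A / (q * X ^+ 2)).
  by rewrite eb; field; rewrite X0 A0 q0.
by rewrite e; field; rewrite X0 A0 Y0 S0 q0 b0 oppr_eq0 oner_neq0.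
Qed.

Lemma R_identity_F (K : fieldType) (q X Y A S Q t P b W : K) :
    q != 0 -> X != 0 -> Y != 0 -> A != 0 -> S != 0 ->
    b = q * A - (q * A)^-1 -> b != 0 ->
  S^-1 * Q * (t * A) * (P * (W / b)) * (q * (Y * A) - (q * (Y * A))^-1) ^+ 2
    + S^-1 * Q * t * P * (- q^-1 / (Y * A) ^+ 2)^-1 * W
  = (- q^-1 * S^-1) * (Q / Y ^+ 2) * t * P * W
    + (- q^-1 / X ^+ 2)^-1 * (Y - Y^-1) ^+ 2
      * ((- q^-1 * S^-1) * (Q / X ^+ 2) * (t * A) * (P * (W / b))).
Proof.
move=> q0 X0 Y0 A0 S0 eb b0.
(* Here the relation is [{y+a+1}^2 - {y}^2 = {a+1}{2y+a+1}]. *)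
have e : (q * (Y * A) - (q * (Y * A))^-1) ^+ 2 =
    (Y - Y^-1) ^+ 2 + b * (q * Y ^+ 2 * A - (q * Y ^+ 2 * A)^-1).
  by rewrite eb; field; rewrite Y0 A0 q0.
by rewrite e; field; rewrite X0 A0 Y0 S0 q0 b0 oppr_eq0 oner_neq0.
Qed.

Section RMatrixCoefficients.
Variables (R : realType) (r : nat).
Hypothesis hr : (2 <= r)%N.
Local Notation C := R[i].
Local Notation q := (qq R r).
Local Notation s := (ss R r).
Local Notation br := (qbrace R r).
Implicit Types (x y a : nat).

Lemma ssE : s = - q^-1.
Proof.
apply: (mulfI (qq_neq0 R hr)); rewrite mulrN mulfV ?qq_neq0 // /ss -exprS.
by rewrite subn1 prednK ?qq_exp_r //; lia.
Qed.

Lemma qbrace_nat (x : nat) : (br (x%:Z)) = q ^+ x - (q ^+ x)^-1.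
Proof. by rewrite /qbrace -invr_expz. Qed.

Lemma qbrace_subn x a : (br (x%:Z - a%:Z)) = q ^+ x / q ^+ a - q ^+ a / q ^+ x.
Proof.
by rewrite /qbrace opprB !expfzDr ?qq_neq0 // -!invr_expz.
Qed.

Lemma kapE x : kap R r x = s / (q ^+ x) ^+ 2.
Proof. by rewrite /kap expfzDr ?qq_neq0 // -invr_expz -exprM mulnC. Qed.

Lemma qbrace_neq0 a : (0 < a < r)%N -> (br (a%:Z)) != 0.
Proof. by move=> /andP[a0 ar]; rewrite qbrace_eq0 // dvdzE /= gtnNdvd. Qed.

(** [q^r = -1] gives [{r - y} = {y}]. *)
Lemma phiE y : phi R r y = ((br (y%:Z)) / (br (1))) ^+ 2.
Proof.
rewrite /phi /qint expr2; congr (_ * (_ / _)).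
rewrite qbrace_subn qq_exp_r // qbrace_nat; field.
by rewrite expf_neq0 ?qq_neq0.
Qed.

(** For [x = a + j] with [j < r] this is the binomial times the product of braces in the definition
    of [R], see [qbinom_prod]. As a product it satisfies one-step recursions in [x] and [a], and it
    vanishes for [a > x], so the sum over [a] can run over all [a < r]. *)
Definition Rprod x a : C := \prod_(m < a) ((br (x%:Z - m%:Z)) ^+ 2 / (br (m.+1%:Z))).

(* Coefficient of [u_x (x) u_y] in [R (u_(y+a) (x) u_(x-a))]. *)
Definition Rcoord x y a : C :=
  (s ^+ (x + y))^-1 * q ^+ (2 * (x * y)) * q ^+ (a * (a - 1))./2 * Rprod x a.

Lemma RprodS x a : Rprod x a.+1 = Rprod x a * ((br (x%:Z - a%:Z)) ^+ 2 / (br (a.+1%:Z))).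
Proof. by rewrite /Rprod big_ord_recr. Qed.

Lemma RprodS_l x a :
  Rprod x.+1 a.+1 = (br (x.+1%:Z)) ^+ 2 / (br (a.+1%:Z)) * Rprod x a.
Proof.
rewrite /Rprod !prodf_div big_ord_recl [X in _ / X]big_ord_recr /= subr0.
rewrite (eq_bigr (fun m : 'I_a => (br (x%:Z - m%:Z)) ^+ 2)) => [|m _].
  by rewrite invfM; ring.
by congr (br _ ^+ 2); rewrite /bump /=; lia.
Qed.

Lemma Rprod_eq0 x a : (x < a)%N -> Rprod x a = 0.
Proof.
move=> xa; apply/eqP/prodf_eq0; exists (Ordinal xa) => //.
by rewrite subrr /qbrace oppr0 subrr expr0n mul0r.
Qed.

Lemma Rcoord_eq0 x y a : (x < a)%N -> Rcoord x y a = 0.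
Proof. by move=> xa; rewrite /Rcoord Rprod_eq0 // mulr0. Qed.

Lemma tri_expS a : q ^+ (a.+1 * (a.+1 - 1))./2 = q ^+ (a * (a - 1))./2 * q ^+ a.
Proof.
have e : (a.+1 * (a.+1 - 1) = a * (a - 1) + a.*2)%N by case: a => // a; nia.
by rewrite -exprD e halfD odd_double andbF doubleK.
Qed.

Lemma qbinom_prod a j : (j < r)%N ->
  qbinom R r (a + j) j * \prod_(0 <= m < a) br (m + j + 1)%N%:Z = Rprod (a + j) a.
Proof.
have b1 := qbrace1_neq0 R hr.
have qfactS k : qfact R r k.+1 = qfact R r k * qint R r k.+1%:Z.
  by rewrite /qfact big_nat_recr.
have qfact0 : qfact R r 0 = 1 by rewrite /qfact big_geq.
have qfact_neq0 k : (k < r)%N -> qfact R r k != 0.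
  elim: k => [_|k IH kr]; first by rewrite qfact0 oner_neq0.
  rewrite qfactS mulf_neq0 ?IH //; first by lia.
  by rewrite /qint mulf_neq0 ?invr_eq0 // qbrace_neq0.
move=> jr; elim: a => [|a IH].
  rewrite /Rprod big_ord0 big_geq // mulr1 /qbinom subnn qfact0 mul1r.
  by rewrite mulfV // qfact_neq0.
have -> : qbinom R r (a.+1 + j) j =
    qbinom R r (a + j) j * (br (a + j).+1%:Z / br a.+1%:Z).
  rewrite /qbinom !addnK addSn !qfactS /qint.
  by rewrite !invfM invrK -[RHS]mulr1 -(mulVf b1); ring.
rewrite big_nat_recr //= addSn RprodS_l -addn1 -IH.
by rewrite addn1; ring.
Qed.

Let q0 := qq_neq0 R hr.

Let brS a : br a.+1%:Z = q * q ^+ a - (q * q ^+ a)^-1.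
Proof. by rewrite qbrace_nat exprS. Qed.

Let expX_subn x a : (a <= x)%N -> q ^+ (x - a) = q ^+ x / q ^+ a.
Proof.
by move=> ax; rewrite -{2}(subnK ax) exprD mulfK // expf_neq0 ?q0.
Qed.

Lemma Rcoord_E0 x y : Rcoord x y 0 = kap R r y * Rcoord x.+1 y 0.
Proof.
rewrite /Rcoord /Rprod !big_ord0 !mulr1 kapE addSn (exprS s) ssE.
have -> : (2 * (x.+1 * y) = 2 * (x * y) + y * 2)%N by ring.
rewrite (exprD q) (exprM q y 2).
have : (- q^-1) ^+ (x + y) != 0 by rewrite expf_neq0 ?oppr_eq0 ?invr_eq0 ?q0.
move: (_ ^+ (x + y)) (q ^+ (2 * (x * y))) (q ^+ y) (expf_neq0 y q0) => S Q Z Z0 S0.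
by field; rewrite Z0 S0 q0 ?oppr_eq0 ?oner_neq0.
Qed.

(** The coefficient of the coordinate at [(y + a + 1, x - a)] in the commutation of [R] with [E] on
    two factors; [Rcoord_E0] is the boundary coefficient. *)
Lemma Rcoord_ES x y a : (a.+1 < r)%N ->
  Rcoord x y a * kap R r (x - a) + Rcoord x y a.+1
  = kap R r y * Rcoord x.+1 y a.+1 + Rcoord x y.+1 a.
Proof.
move=> ar; case: (leqP a x) => [ax|xa]; last first.
  by rewrite !Rcoord_eq0 ?mulr0 ?mul0r ?addr0 //; lia.
rewrite /Rcoord !kapE addnS addSn (exprS s) !tri_expS RprodS_l RprodS qbrace_subn ssE.
have -> : (2 * (x.+1 * y) = 2 * (x * y) + y * 2)%N by ring.
have -> : (2 * (x * y.+1) = 2 * (x * y) + x * 2)%N by ring.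
rewrite (exprD q _ (y * 2)) (exprD q _ (x * 2)) (exprM q y 2) (exprM q x 2).
rewrite (expX_subn ax) (brS x).
have p0 : - q^-1 != 0 by rewrite oppr_eq0 invr_eq0 q0.
by apply: R_identity_E; rewrite ?(expf_neq0 _ q0) ?(expf_neq0 _ p0) ?q0 ?qbrace_neq0.
Qed.

Lemma Rcoord_F0 x y :
  Rcoord x y.+1 0 * phi R r y.+1 = (kap R r x)^-1 * phi R r y.+1 * Rcoord x y 0.
Proof.
rewrite /Rcoord /Rprod !big_ord0 !mulr1 kapE addnS (exprS s) ssE.
have -> : (2 * (x * y.+1) = 2 * (x * y) + x * 2)%N by ring.
rewrite (exprD q) (exprM q x 2).
have : (- q^-1) ^+ (x + y) != 0 by rewrite expf_neq0 ?oppr_eq0 ?invr_eq0 ?q0.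
move: (_ ^+ (x + y)) (q ^+ (2 * (x * y))) (q ^+ x) (expf_neq0 x q0) => S Q Z Z0 S0.
by field; rewrite Z0 S0 q0 ?oppr_eq0 ?oner_neq0.
Qed.

(** The coefficient of the coordinate at [(y + a, x - a)] in the commutation with [F]. All four
    terms are written through the data at [(x + 1, y, a)], after which [{1}^-2] factors out. *)
Lemma Rcoord_FS x y a : (a.+1 < r)%N ->
  Rcoord x.+1 y a.+1 * phi R r (y + a).+1
    + Rcoord x.+1 y a * (kap R r (y + a))^-1 * phi R r (x.+1 - a)
  = phi R r x.+1 * Rcoord x y a
    + (kap R r x.+1)^-1 * phi R r y * Rcoord x.+1 y.-1 a.+1.
Proof.
move=> ar; case: (leqP a x) => [ax|xa]; last first.
  rewrite !(@Rcoord_eq0 _ _ a.+1) ?(@Rcoord_eq0 x) //.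
  rewrite (_ : (x.+1 - a)%N = 0%N) ?phi0 ?mulr0 ?mul0r ?addr0 //; lia.
set S := s ^+ (x.+1 + y); set Q := q ^+ (2 * (x.+1 * y)).
set t := q ^+ (a * (a - 1))./2; set P := Rprod x.+1 a.
set W := br (x.+1%:Z - a%:Z) ^+ 2; set beta := (br 1)^-1 ^+ 2.
have s0 : s != 0 by rewrite ssE oppr_eq0 invr_eq0 q0.
have phiE' z : phi R r z = br z%:Z ^+ 2 * beta by rewrite phiE exprMn.
have b0 : br a.+1%:Z != 0 by rewrite qbrace_neq0.
have term3 : phi R r x.+1 * Rcoord x y a =
    beta * ((s * S^-1) * (Q / (q ^+ y) ^+ 2) * t * P * W).
  have e : br x.+1%:Z ^+ 2 * Rprod x a = P * W.
    have := RprodS_l x a; rewrite RprodS -/P -/W => e.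
    have := congr1 ( *%R (br a.+1%:Z)) e.
    by rewrite /= [LHS](_ : _ = P * W); [move->|]; field.
  rewrite phiE' /Rcoord /S /Q addSn (exprS s).
  have -> : (2 * (x.+1 * y) = 2 * (x * y) + y * 2)%N by ring.
  rewrite (exprD q _ (y * 2)) (exprM q y 2) -[in RHS]mulrA -e -/t.
  by field; rewrite (expf_neq0 _ q0) (expf_neq0 _ s0) s0.
have term4 : (kap R r x.+1)^-1 * phi R r y * Rcoord x.+1 y.-1 a.+1 =
    beta * ((kap R r x.+1)^-1 * br y%:Z ^+ 2
      * ((s * S^-1) * (Q / (q ^+ x.+1) ^+ 2) * (t * q ^+ a) * (P * (W / br a.+1%:Z)))).
  (* For [y = 0] the truncated index [y.-1] is meaningless, but [{y} = 0] removes both sides. *)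
  rewrite phiE' /S /Q; case: (y) => [|z].
    by rewrite /qbrace oppr0 subrr expr0n !(mul0r, mulr0).
  rewrite /Rcoord /= addnS (exprS s) tri_expS RprodS -/t -/P -/W.
  have -> : (2 * (x.+1 * z.+1) = 2 * (x.+1 * z) + x.+1 * 2)%N by ring.
  rewrite (exprD q _ (x.+1 * 2)) (exprM q x.+1 2).
  move: (kap R r x.+1)^-1 (br z.+1%:Z) => k b.
  by field; rewrite b0 (expf_neq0 _ q0) ?(expf_neq0 _ s0) ?s0.
rewrite term3 term4 -mulrDr !phiE' (_ : br (x.+1 - a)%N%:Z = br (x.+1%:Z - a%:Z)); last first.
  by congr br; lia.
rewrite -/W /Rcoord tri_expS RprodS -/P -/W -/S -/Q -/t !kapE (brS (y + a)) exprD ssE.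
rewrite (qbrace_nat y) -(R_identity_F (q := q) (A := q ^+ a)) ?(expf_neq0 _ q0) //.
  by ring.
exact: expf_neq0 s0.
Qed.

Lemma RcoefE x y i j : (x < r)%N -> (i < r)%N -> (j < r)%N ->
  Rcoef R r x y i j =
  \sum_(a < r) Rcoord x y a *+ ((i == y + a)%N && (j == x - a)%N).
Proof.
move=> xr ir jr; rewrite /Rcoef big_mkord (big_ord_widen r (fun a =>
  (q ^+ (2 * (i - a) * (j + a)) * q ^+ (a * (a - 1))./2 * qbinom R r (a + j) j
   * \prod_(0 <= m < a) qbrace R r (m + j + 1)%N%:Z)
    *+ ((x == j + a)%N && (y == i - a)%N))); last by lia.
rewrite big_mkcond mulr_sumr; apply: eq_bigr => a _.
case: (ltnP x a) => xa.
  rewrite Rcoord_eq0 // mul0rn (_ : (x == j + a)%N = false); last by lia.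
  by rewrite mulr0n if_same mulr0.
case: ifP => ai; last first.
  by rewrite mulr0 (_ : (_ && _) = false) ?mulr0n //; lia.
rewrite (_ : (i == _)%N && _ = ((x == j + a) && (y == i - a))%N); last by lia.
case: andP => [[/eqP xe /eqP ye]|_]; last by rewrite mulr0n mulr0.
rewrite !mulr1n -mulrA qbinom_prod // /Rcoord.
rewrite (_ : (a + j = x)%N); last by lia.
rewrite (_ : (i + j = x + y)%N); last by lia.
rewrite (_ : (2 * (i - a) * (j + a) = 2 * (x * y))%N); last by rewrite -xe -ye; ring.
by rewrite !mulrA.
Qed.
End RMatrixCoefficients.

(** * The braid group action *)

Section SumShift.
Variable K : nmodType.
Implicit Type F : nat -> K.

(** On each side of the commutation relation two consecutive values of [a] contribute to the same
    coordinate, so the coefficients match only after one of the two sums is shifted by one. *)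
Lemma sum_shift_match (A B C D : nat -> K) k : (0 < k)%N ->
    A k.-1 = 0 -> D k.-1 = 0 -> B 0%N = C 0%N ->
    (forall a, (a < k.-1)%N -> A a + B a.+1 = C a.+1 + D a) ->
  \sum_(a < k) (A a + B a) = \sum_(a < k) (C a + D a).
Proof.
case: k => // k _ /= Ak Dk BC0 H; rewrite !big_split /=.
rewrite (big_ord_recr _ (fun a => A a)) (big_ord_recl _ (fun a => B a)).
rewrite (big_ord_recl _ (fun a => C a)) (big_ord_recr _ (fun a => D a)) /=.
rewrite Ak Dk !addr0 addrCA BC0 -addrA; congr (_ + _).
by rewrite -!big_split; apply: eq_bigr => a _; apply: H.
Qed.
End SumShift.

(** * The [R]-matrix commutes with [E] and [F] on two tensor factors *)

Section TwoFactors.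
Variables (R : realType) (r : nat).
Hypothesis hr : (2 <= r)%N.
Local Notation C := R[i].
Local Notation Rc := (Rcoord R r).
Implicit Types (x y a : nat) (g : nat -> nat -> C).

(** The factor of [Rprod] with index [x - r] is [{r}^2 / {x - r + 1}], and [{r} = 0]. *)
Lemma Rcoord_eq0_ge x y a : (r <= x)%N -> (x - a < r)%N -> Rc x y a = 0.
Proof.
move=> rx xa; have ma : (x - r < a)%N by lia.
rewrite /Rcoord; suff -> : Rprod R r x a = 0 by rewrite mulr0.
apply/eqP/prodf_eq0; exists (Ordinal ma) => //=.
have /eqP -> : qbrace R r (x%:Z - (x - r)%N%:Z) == 0.
  by rewrite qbrace_eq0 // (_ : _ - _ = r%:Z) ?dvdzz //; lia.
by rewrite expr0n mul0r.
Qed.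

Lemma Rcoord_tensE g x y : (forall i j, (r <= i)%N -> g i j = 0) ->
  \sum_(a < r) Rc x y a
     * (kap R r (x - a) * g (y + a).+1 (x - a)%N + g (y + a)%N (x - a).+1)
  = kap R r y * (\sum_(a < r) Rc x.+1 y a * g (y + a)%N (x.+1 - a)%N)
    + \sum_(a < r) Rc x y.+1 a * g (y.+1 + a)%N (x - a)%N.
Proof.
move=> g0; have r0 : (0 < r)%N by lia.
rewrite mulr_sumr -big_split /=; under eq_bigr do rewrite mulrDr.
apply: (@sum_shift_match _
  (fun a => Rc x y a * (kap R r (x - a) * g (y + a).+1 (x - a)%N))
  (fun a => Rc x y a * g (y + a)%N (x - a).+1)
  (fun a => kap R r y * (Rc x.+1 y a * g (y + a)%N (x.+1 - a)%N))
  (fun a => Rc x y.+1 a * g (y.+1 + a)%N (x - a)%N)) => //.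
- by rewrite g0 ?mulr0 //; lia.
- by rewrite g0 ?mulr0 //; lia.
- by rewrite !addn0 !subn0 mulrA -(Rcoord_E0 _ hr).
move=> a ar.
have -> : Rc x y a.+1 * g (y + a.+1)%N (x - a.+1).+1 =
    Rc x y a.+1 * g (y + a).+1 (x - a)%N.
  rewrite addnS; case: (ltnP a x) => ax; first by rewrite subnSK.
  by rewrite Rcoord_eq0 ?mul0r //; lia.
rewrite addnS subSS addSn [Rc x y a * _]mulrA [kap R r y * _]mulrA.
by rewrite -!mulrDl (Rcoord_ES _ hr) //; lia.
Qed.

(** The boundary terms at [a = r - 1] vanish for another reason than with [E]: not because [g] is 0
    out of range, but because [x < r] makes either [phi] or the coefficient of [R] vanish. *)
Lemma Rcoord_tensF g x y : (x < r)%N ->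
  \sum_(a < r) Rc x y a
     * (phi R r (y + a) * g (y + a).-1 (x - a)%N
        + (kap R r (y + a))^-1 * phi R r (x - a) * g (y + a)%N (x - a).-1)
  = phi R r x * (\sum_(a < r) Rc x.-1 y a * g (y + a)%N (x.-1 - a)%N)
    + (kap R r x)^-1 * phi R r y
      * \sum_(a < r) Rc x y.-1 a * g (y.-1 + a)%N (x - a)%N.
Proof.
move=> xr; have r0 : (0 < r)%N by lia.
rewrite !mulr_sumr addrC -big_split /=.
under eq_bigr do rewrite mulrDr addrC.
apply: (@sum_shift_match _
  (fun a => Rc x y a * ((kap R r (y + a))^-1 * phi R r (x - a) * g (y + a)%N (x - a).-1))
  (fun a => Rc x y a * (phi R r (y + a) * g (y + a).-1 (x - a)%N))
  (fun a => (kap R r x)^-1 * phi R r y * (Rc x y.-1 a * g (y.-1 + a)%N (x - a)%N))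
  (fun a => phi R r x * (Rc x.-1 y a * g (y + a)%N (x.-1 - a)%N))) => //.
- rewrite (_ : (x - r.-1)%N = 0%N) ?phi0 ?(mulr0, mul0r) //; lia.
- case: (posnP x) => [->|x0]; first by rewrite phi0 // mul0r.
  by rewrite Rcoord_eq0 ?mul0r ?mulr0 //; lia.
- rewrite !addn0 !subn0; case: (y) => [|z] /=.
    by rewrite phi0 // !(mul0r, mulr0).
  by rewrite [LHS]mulrA [RHS]mulrA (Rcoord_F0 _ hr).
move=> a ar; have {}ar : (a.+1 < r)%N by lia.
rewrite addnS /= -subnS (_ : (x.-1 - a = x - a.+1)%N); last by lia.
have -> : (kap R r x)^-1 * phi R r y * (Rc x y.-1 a.+1 * g (y.-1 + a.+1)%N (x - a.+1)%N)
   = (kap R r x)^-1 * phi R r y * Rc x y.-1 a.+1 * g (y + a)%N (x - a.+1)%N.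
  case: (posnP y) => [->|y0]; first by rewrite phi0 // !(mul0r, mulr0).
  by rewrite mulrA (_ : (y.-1 + a.+1 = y + a)%N) //; lia.
rewrite [Rc x y a * _]mulrA [Rc x y a.+1 * _]mulrA [phi R r x * _]mulrA -!mulrDl.
congr (_ * _); rewrite addrC [RHS]addrC [Rc x y a * _]mulrA.
case: (x) => [|x']; last exact: Rcoord_FS.
by rewrite !(@Rcoord_eq0 _ _ 0 _ a.+1) // phi0 // !(mul0r, mulr0, addr0).
Qed.
End TwoFactors.

Section BraidOperators.
Variables (R : realType) (r n : nat).
Hypothesis hr : (2 <= r)%N.
Local Notation C := R[i].
Local Notation T := (tensor R r n).
Local Notation tE := (tensE R r n).
Local Notation tF := (tensF R r n).
Implicit Types (eta : nindex n) (v : T) (eps : mindex r n).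

Section Generator.
Variable i : 'I_n.-1.
Let L := pos_l i.
Let P := pos_r i.

Let PL : (P == L) = false.
Proof. by rewrite -val_eqE /= gtn_eqF. Qed.

Definition upd2 eta (a b : nat) : nindex n := upd (upd eta L a) P b.

Lemma upd2E eta a b t :
  upd2 eta a b t = if t == P then b else if t == L then a else eta t.
Proof. by rewrite !updE. Qed.

Lemma sigma_coord v eps :
  sigma R r i v eps = \sum_(a < r) Rcoord R r (eps L) (eps P) a
     * coord v (upd2 (nindex_of eps) (eps P + a) (eps L - a)).
Proof.
rewrite /sigma /kernel_op lfunE /= ffunE.
transitivity (\sum_e \sum_(a < r) Rcoord R r (eps L) (eps P) a
   * (if nindex_of e == upd2 (nindex_of eps) (eps P + a) (eps L - a) then v e else 0)).
  apply: eq_bigr => e _; rewrite RcoefE // -/L -/P -sumrMnl mulr_suml.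
  apply: eq_bigr => a _; rewrite -mulrnA mulnb.
  suff -> : (nindex_of e == upd2 (nindex_of eps) (eps P + a) (eps L - a)) =
     ((e L == eps P + a :> nat) && (e P == eps L - a :> nat))%N
     && [forall t, (t != L) && (t != P) ==> (eps t == e t)].
    by case: ifP; rewrite ?mulr1n // mulr0n mul0r mulr0.
  apply/eqP/andP => [/ffunP H|[/andP[/eqP HL /eqP HP] /forallP H]].
    have := H L; rewrite upd2E (eq_sym L) PL eqxx !ffunE => ->.
    have := H P; rewrite upd2E eqxx !ffunE => ->; rewrite !eqxx; split=> //.
    apply/forallP => t; apply/implyP => /andP[/negbTE tL /negbTE tP].
    by have := H t; rewrite upd2E tL tP !ffunE => /val_inj ->.
  apply/ffunP => t; rewrite upd2E !ffunE; case: (eqVneq t P) => [->//|tP].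
  case: (eqVneq t L) => [->//|tL].
  by have /implyP := H t; rewrite tL tP => /(_ isT) /eqP ->.
rewrite exchange_big /=; apply: eq_bigr => a _.
by rewrite -mulr_sumr /coord [in RHS]big_mkcond.
Qed.

Lemma upd2_L eta a b : upd2 eta a b L = a.
Proof. by rewrite upd2E eqxx eq_sym PL. Qed.

Lemma upd2_P eta a b : upd2 eta a b P = b.
Proof. by rewrite upd2E eqxx. Qed.

Lemma upd2_far eta a b t : t != L -> t != P -> upd2 eta a b t = eta t.
Proof. by rewrite upd2E => /negbTE -> /negbTE ->. Qed.

Lemma coord_sigma v eta :
  coord (sigma R r i v) eta = \sum_(a < r) Rcoord R r (eta L) (eta P) a
     * coord v (upd2 eta (eta P + a) (eta L - a)).
Proof.
case: (nindexP r eta) => [[eps ->]|[t Ht]].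
  rewrite coordE sigma_coord; apply: eq_bigr => a _.
  by rewrite [nindex_of eps L]ffunE [nindex_of eps P]ffunE.
rewrite (coord_out _ Ht) big1 // => a _.
case: (eqVneq t P) => [tP|tP].
  by rewrite (@coord_out _ _ _ _ _ L) ?mulr0 // upd2_L -tP; lia.
case: (eqVneq t L) => [tL|tL]; last first.
  by rewrite (@coord_out _ _ _ _ _ t) ?mulr0 // upd2_far.
case: (ltnP (eta L - a) r) => xa.
  by rewrite (Rcoord_eq0_ge _ hr) ?mul0r // -tL.
by rewrite (@coord_out _ _ _ _ _ P) ?mulr0 // upd2_P.
Qed.

Lemma sum_adjacent (F : 'I_n -> C) :
  \sum_t F t = F L + F P + \sum_(t | (t != L) && (t != P)) F t.
Proof.
by rewrite (bigD1 L) //= (bigD1 P) ?PL //= addrA.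
Qed.

(** The range [Q] contains both positions of the adjacent pair or neither, so only the product of
    the two weights matters; [kap_balance] says that [R] preserves it. *)
Lemma prod_far (Q : pred 'I_n) (f : nat -> C) eta a b :
    Q L = Q P -> f a * f b = f (eta L) * f (eta P) ->
  \prod_(t | Q t) f (upd2 eta a b t) = \prod_(t | Q t) f (eta t).
Proof.
move=> QLP fab; case: (boolP (Q L)) => QL.
  have QP : Q P && (P != L) by rewrite -QLP QL PL.
  rewrite (bigD1 L QL) (bigD1 P QP) [RHS](bigD1 L QL) [X in _ = _ * X](bigD1 P QP) /=.
  rewrite upd2_L upd2_P !mulrA fab; congr (_ * _).
  by apply: eq_bigr => t /andP[/andP[_ tL] tP]; rewrite upd2_far.
apply: eq_bigr => t Qt; rewrite upd2_far //.
  by apply: contraNneq QL => <-.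
by rewrite QLP in QL; apply: contraNneq QL => <-.
Qed.

Let upd2_updL eta c a b : upd2 (upd eta L c) a b = upd2 eta a b.
Proof. by rewrite /upd2 upd_upd. Qed.

Let upd2_updP eta c a b : upd2 (upd eta P c) a b = upd2 eta a b.
Proof.
by apply/ffunP => t; rewrite !upd2E updE; case: eqP.
Qed.

Let upd_upd2L eta a b c : upd (upd2 eta a b) L c = upd2 eta c b.
Proof.
apply/ffunP => t; rewrite updE !upd2E.
by case: (eqVneq t L) => // ->; rewrite eq_sym PL.
Qed.

Let upd_upd2P eta a b c : upd (upd2 eta a b) P c = upd2 eta a c.
Proof. by rewrite /upd2 upd_upd. Qed.

Let upd_upd2_far eta a b t c : t != L -> t != P ->
  upd (upd2 eta a b) t c = upd2 (upd eta t c) a b.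
Proof.
move=> tL tP; apply/ffunP => s; rewrite updE !upd2E updE.
case: (eqVneq s t) => // ->.
by rewrite (negbTE tL) (negbTE tP).
Qed.

Let kap_balance x y a : (a <= x)%N ->
  kap R r (y + a) * kap R r (x - a) = kap R r x * kap R r y.
Proof.
by move=> ax; rewrite /kap -!expfzDr ?qq_neq0 //; congr (_ ^ _); lia.
Qed.

(** The coproduct terms at the adjacent pair give [Rcoord_tensE] times the weight [K P] of the
    factors to its right. In every other term [E] acts away from the pair and meets it only through
    the preserved product of weights. *)
Lemma sigma_tensE v : sigma R r i (tE v) = tE (sigma R r i v).
Proof.
apply: coord_ext => eta; rewrite coord_sigma coord_tensE //.
rewrite [RHS]sum_adjacent.
set x := eta L; set y := eta P; set K := fun t => \prod_(s < n | (t < s)%N) kap R r (eta s).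
transitivity (\sum_(a < r) (K P * (Rcoord R r x y a * (
     kap R r (x - a) * coord v (upd2 eta (y + a).+1 (x - a))
     + coord v (upd2 eta (y + a) (x - a).+1)))
  + \sum_(t | (t != L) && (t != P)) K t * (Rcoord R r x y a *
      coord v (upd2 (upd eta t (eta t).+1) (y + a) (x - a))))).
  apply: eq_bigr => a _; case: (leqP a x) => ax; last first.
    by rewrite Rcoord_eq0 // !(mul0r, mulr0) add0r big1 // => t _; rewrite mul0r mulr0.
  rewrite coord_tensE // sum_adjacent mulrDr; congr (_ + _).
    have -> : \prod_(s < n | (L < s)%N) kap R r (upd2 eta (y + a) (x - a) s) =
       kap R r (x - a) * K P.
      rewrite (bigD1 P) /= ?ltnSn // upd2_P; congr (_ * _).
      apply: eq_big => [s|s /andP[Ls sP]]; first by rewrite -val_eqE /=; lia.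
      by rewrite upd2_far // -val_eqE /= gtn_eqF.
    have -> : \prod_(s < n | (P < s)%N) kap R r (upd2 eta (y + a) (x - a) s) = K P.
      by apply: eq_bigr => s Ps; rewrite upd2_far // -val_eqE /= gtn_eqF //=; move: Ps => /=; lia.
    by rewrite upd2_L upd2_P upd_upd2L upd_upd2P; ring.
  rewrite mulr_sumr; apply: eq_bigr => t /andP[tL tP].
  rewrite upd_upd2_far // upd2_far // prod_far ?kap_balance //; first by rewrite mulrCA.
  by move: tL tP; rewrite -!val_eqE /=; lia.
have g0 a b : (r <= a)%N -> coord v (upd2 eta a b) = 0.
  by move=> ra; rewrite (@coord_out _ _ _ _ _ L) // upd2_L.
have /= key := Rcoord_tensE hr x y g0.
rewrite big_split /= -mulr_sumr key.
congr (_ + _).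
  have -> : \prod_(s < n | (L < s)%N) kap R r (eta s) = kap R r y * K P.
    rewrite (bigD1 P) /= ?ltnSn //; congr (_ * _).
    by apply: eq_bigl => s; rewrite -val_eqE /=; lia.
  rewrite !coord_sigma !upd_same !updE PL (eq_sym L) PL mulrDr mulrA [K P * _]mulrC.
  congr (_ * _ + _ * _); apply: eq_bigr => a _; first by rewrite upd2_updL.
  by rewrite upd2_updP.
rewrite exchange_big; apply: eq_bigr => t /andP[tL tP] /=.
rewrite coord_sigma !updE !(eq_sym _ t) (negbTE tL) (negbTE tP) -mulr_sumr.
by [].
Qed.

Lemma sigma_tensF v : sigma R r i (tF v) = tF (sigma R r i v).
Proof.
(* Coordinates are compared at valid indices only, since the two-factor identity for [F] requires
   [x < r]. *)
apply/ffunP => eps; rewrite -!coordE coord_sigma coord_tensF //.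
set eta := nindex_of eps; rewrite [RHS]sum_adjacent.
set x := eta L; set y := eta P.
have xr : (x < r)%N by rewrite /x ffunE.
set K := fun t : 'I_n => \prod_(s < n | (s < t)%N) (kap R r (eta s))^-1.
transitivity (\sum_(a < r) (K L * (Rcoord R r x y a * (
     phi R r (y + a) * coord v (upd2 eta (y + a).-1 (x - a))
     + (kap R r (y + a))^-1 * phi R r (x - a) * coord v (upd2 eta (y + a) (x - a).-1)))
  + \sum_(t | (t != L) && (t != P)) K t * phi R r (eta t) * (Rcoord R r x y a *
      coord v (upd2 (upd eta t (eta t).-1) (y + a) (x - a))))).
  apply: eq_bigr => a _; case: (leqP a x) => ax; last first.
    by rewrite Rcoord_eq0 // !(mul0r, mulr0) add0r big1 // => t _; rewrite mul0r mulr0.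
  rewrite coord_tensF // sum_adjacent mulrDr; congr (_ + _).
    have -> : \prod_(s < n | (s < P)%N) (kap R r (upd2 eta (y + a) (x - a) s))^-1 =
       (kap R r (y + a))^-1 * K L.
      rewrite (bigD1 L) /= ?ltnSn // upd2_L; congr (_ * _).
      apply: eq_big => [s|s /andP[sP sL]]; first by rewrite -val_eqE /=; lia.
      by rewrite upd2_far // -val_eqE /= ltn_eqF.
    have -> : \prod_(s < n | (s < L)%N) (kap R r (upd2 eta (y + a) (x - a) s))^-1 = K L.
      apply: eq_bigr => s sL; rewrite upd2_far // -val_eqE /= ltn_eqF //=.
      by apply: leq_trans sL _.
    by rewrite upd2_L upd2_P upd_upd2L upd_upd2P; ring.
  rewrite mulr_sumr; apply: eq_bigr => t /andP[tL tP].
  rewrite upd_upd2_far // upd2_far //.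
  rewrite (@prod_far _ (fun b => (kap R r b)^-1)) -?invfM ?kap_balance //.
    by rewrite mulrCA.
  by move: tL tP; rewrite -!val_eqE /=; lia.
have /= key := Rcoord_tensF hr (fun a b => coord v (upd2 eta a b)) y xr.
rewrite big_split /= -mulr_sumr key.
congr (_ + _).
  have -> : \prod_(s < n | (s < P)%N) (kap R r (eta s))^-1 = (kap R r x)^-1 * K L.
    rewrite (bigD1 L) /= ?ltnSn //; congr (_ * _).
    by apply: eq_bigl => s; rewrite -val_eqE /=; lia.
  have eL : \sum_(a < r) Rcoord R r x.-1 y a * coord v (upd2 eta (y + a) (x.-1 - a))
      = coord (sigma R r i v) (upd eta L x.-1).
    rewrite coord_sigma upd_same updE PL.
    by apply: eq_bigr => a _; rewrite upd2_updL.
  have eP : \sum_(a < r) Rcoord R r x y.-1 a * coord v (upd2 eta (y.-1 + a) (x - a))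
      = coord (sigma R r i v) (upd eta P y.-1).
    rewrite coord_sigma upd_same updE (eq_sym L) PL.
    by apply: eq_bigr => a _; rewrite upd2_updP.
  rewrite eL eP; move: (coord _ _) (coord _ (upd eta P _)) (kap R r x)^-1 => b c k.
  by rewrite mulrDr !mulrA [K L * k]mulrC.
rewrite exchange_big; apply: eq_bigr => t /andP[tL tP] /=.
by rewrite coord_sigma !updE !(eq_sym _ t) (negbTE tL) (negbTE tP) -mulr_sumr.
Qed.

Lemma degree_upd2 eta (a : nat) : (a <= eta L)%N ->
  degree (upd2 eta (eta P + a) (eta L - a)) = degree eta.
Proof.
by move=> aL; rewrite /upd2 !degree_upd updE PL; lia.
Qed.

Lemma hproj_sigma x v : hproj x (sigma R r i v) = sigma R r i (hproj x v).
Proof.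
apply: coord_ext => eta; rewrite coord_hproj !coord_sigma.
transitivity (\sum_(a < r) if degree eta == x then Rcoord R r (eta L) (eta P) a
     * coord v (upd2 eta (eta P + a) (eta L - a)) else 0).
  by case: ifP => // _; rewrite big1.
apply: eq_bigr => a _; rewrite coord_hproj.
case: (leqP a (eta L)) => ax; first by rewrite degree_upd2 //; case: ifP; rewrite ?mulr0.
by rewrite Rcoord_eq0 // !mul0r if_same.
Qed.

Lemma Rcoord0_neq0 x y : Rcoord R r x y 0 != 0.
Proof.
rewrite /Rcoord /Rprod big_ord0 mulr1.
have q0 := qq_neq0 R hr; have s0 : ss R r != 0 := expf_neq0 _ q0.
by rewrite !mulf_neq0 ?invr_eq0 ?(expf_neq0 _ s0) ?(expf_neq0 _ q0).
Qed.

(* The terms with [a > 0] only involve coordinates of [v] whose right entry is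
   smaller than [eta L], so the system is triangular. *)
Lemma ker_sigma v : sigma R r i v = 0 -> v = 0.
Proof.
move=> sv0; apply: coord_ext => eta; rewrite coord0.
move: {2}(eta P).+1 (ltnSn (eta P)) => k; elim: k eta => // k IH eta ek.
have /esym/eqP := coord_sigma v (upd2 eta (eta P) (eta L)).
rewrite sv0 coord0 upd2_L upd2_P (bigD1 (Ordinal (ltnW hr))) //= big1; last first.
  move=> a; rewrite -val_eqE /= => a0.
  case: (leqP a (eta P)) => aP; last by rewrite Rcoord_eq0 ?mul0r.
  by rewrite IH ?mulr0 // upd2_P; lia.
rewrite addr0 addn0 subn0 mulf_eq0 (negbTE (Rcoord0_neq0 _ _)) /=.
have -> : upd2 (upd2 eta (eta P) (eta L)) (eta L) (eta P) = eta.
  apply/ffunP => t; rewrite !upd2E.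
  by case: eqP => [->//|_]; case: eqP => [->|].
by move/eqP.
Qed.

(** Injectivity makes the formal inverse in [braid_letter] a true two-sided inverse of the
    endomorphism [sigma]. *)
Lemma sigma_inv (f : 'End(T)) v :
    (forall u, f (sigma R r i u) = sigma R r i (f u)) ->
  f ((sigma R r i)^-1%VF v) = (sigma R r i)^-1%VF (f v).
Proof.
have k0 : lker (sigma R r i) == 0%VS.
  apply/lker0P => u w /eqP; rewrite -subr_eq0 -linearB /= => /eqP /ker_sigma.
  by move/eqP; rewrite subr_eq0 => /eqP.
by move=> comm; rewrite -{2}(lker0_lfunVK k0 v) comm lker0_lfunK.
Qed.

Lemma letter_comm (f : 'End(T)) b v :
    (forall u, f (sigma R r i u) = sigma R r i (f u)) ->
  f (braid_letter R r (i, b) v) = braid_letter R r (i, b) (f v).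
Proof. by move=> comm; rewrite /braid_letter /=; case: b; [|apply: sigma_inv]. Qed.

End Generator.
Lemma braid_comm (f : 'End(T)) (w : braid_word n) v :
    (forall i u, f (sigma R r i u) = sigma R r i (f u)) ->
  f (braid_act R r w v) = braid_act R r w (f v).
Proof.
move=> comm; elim: w => [|[i b] w IH] /=; first by rewrite !id_lfunE.
by rewrite !comp_lfunE letter_comm // IH.
Qed.

End BraidOperators.

(** * Dimensions of the spaces of highest weight vectors *)

Section HighestWeightSpaces.
Variables (R : realType) (r n : nat).
Hypothesis hr : (2 <= r)%N.
Local Notation C := R[i].
Local Notation T := (tensor R r n).
Local Notation tE := (tensE R r n).
Local Notation tF := (tensF R r n).
Local Notation D := (tensD R r n).
Local Notation W := (Wnl R r n).
Implicit Types (u v : T) (eta : nindex n) (eps : mindex r n).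

Lemma memv_Wnl l v : (v \in W l) <-> homog l%:Z v /\ tE v = 0.
Proof.
rewrite /Wnl memv_cap memv_ker; split=> [/andP[/eqP Ev /memv_Vnl hv]|[/memv_Vnl hv ->]].
  by split.
by rewrite eqxx hv.
Qed.

Lemma coord_linear a u v eta :
  coord (a *: u + v) eta = a * coord u eta + coord v eta.
Proof.
case: (nindexP r eta) => [[eps ->]|[t Ht]]; first by rewrite !coordE !ffunE.
by rewrite !(coord_out _ Ht) mulr0 addr0.
Qed.

Definition pullback (P : pred (nindex n)) (f : nindex n -> nindex n) v : T :=
  [ffun eps => if P (nindex_of eps) then coord v (f (nindex_of eps)) else 0].

Fact pullback_is_linear P f : linear (pullback P f).
Proof.
move=> a u v; apply/ffunP => eps; rewrite [in RHS]ffunE tensor_scaleE !ffunE.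
by case: ifP => _; rewrite ?coord_linear // mulr0 addr0.
Qed.
HB.instance Definition _ P f :=
  GRing.isLinear.Build C T T *:%R (pullback P f) (pullback_is_linear P f).

Variable o : 'I_n.
Hypothesis ho : o.+1 = n.
Hypothesis HD : is_Dmodule r D.

(* A vector of [ker E] is determined by its coordinates with last entry 0, and
   those can be prescribed arbitrarily. *)
Definition last0 : 'End(T) := linfun (pullback (fun eta => eta o == 0%N) id).

Lemma coord_last0 v eta : coord (last0 v) eta = if eta o == 0%N then coord v eta else 0.
Proof.
rewrite lfunE /=; case: (nindexP r eta) => [[eps ->]|[t Ht]].
  by rewrite coordE ffunE.
by rewrite !(coord_out _ Ht) if_same.
Qed.

Lemma last0_homog x v : homog x v -> homog x (last0 v).
Proof.
move=> hv; apply: coord_ext => eta; rewrite coord_hproj coord_last0.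
have := coord_hproj x v eta; rewrite hv => ->.
by case: (degree eta == x); rewrite ?if_same.
Qed.

Lemma last0_inj v : tE v = 0 -> last0 v = 0 -> v = 0.
Proof.
move=> Ev v0; apply: (ker_tensE_last hr ho Ev) => eta e0.
by have := coord_last0 v eta; rewrite v0 coord0 e0.
Qed.

Lemma last0_lift l v : homog l%:Z v -> last0 v = v ->
  exists2 w, w \in W l & last0 w = v.
Proof.
move=> hv v0; pose y : T := of_coord r (fun eta' =>
    if eta' o == (r - 1)%N then coord v (upd eta' o 0) else 0).
pose w := iter (r - 1) tE y; exists (hproj l%:Z w).
  apply/memv_Wnl; split; first exact: homog_hproj.
  rewrite tensE_hproj // /w -iterS subn1 prednK ?(tensE_nil HD) ?linear0 //.
  by lia.
apply: coord_ext => eta; rewrite coord_last0 coord_hproj.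
rewrite -[in RHS]v0 coord_last0; case: eqP => // e0.
rewrite /w iter_tensE_last ?e0 ?subnn //; last by lia.
have -> : upd eta o 0 = eta by rewrite -{1}e0 upd_id.
by have := coord_hproj l%:Z v eta; rewrite hv => <-.
Qed.

Definition last0_space l : {vspace T} := (last0 @: W l)%VS.

Lemma memv_last0_space l v : (v \in last0_space l) <-> homog l%:Z v /\ last0 v = v.
Proof.
split=> [/memv_imgP[w /memv_Wnl[hw _] ->]|[hv v0]].
  split; first exact: last0_homog.
  by apply: coord_ext => eta; rewrite !coord_last0; case: (eta o == 0%N).
by have [w wW <-] := last0_lift hv v0; apply: memv_img.
Qed.

Lemma dim_last0_space l : \dim (last0_space l) = \dim (W l).
Proof.
rewrite -[RHS](limg_ker_dim last0 (W l)); suff -> : (W l :&: lker last0 = 0)%VS.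
  by rewrite dimv0.
apply/eqP; rewrite -subv0; apply/subvP => v; rewrite memv_cap memv_ker memv0.
by move=> /andP[/memv_Wnl[_ Ev] /eqP v0]; apply/eqP/last0_inj.
Qed.

Lemma basis_homog eps l : (\sum_t eps t = l)%N -> homog l%:Z (basis_vec R eps).
Proof.
move=> el; apply/memv_Vnl; apply: (subvP (sumv_sup eps _ (subvv _))); last exact: memv_line.
by rewrite el.
Qed.

Lemma basis_neq0 eps : basis_vec R eps != 0.
Proof.
apply/negP => /eqP /ffunP /(_ eps); rewrite !ffunE eqxx => /eqP.
by rewrite oner_eq0.
Qed.

Lemma basis_last0 eps : eps o = 0%N :> nat -> last0 (basis_vec R eps) = basis_vec R eps.
Proof.
move=> e0; apply/ffunP => e; rewrite -!coordE coord_last0 coordE !ffunE.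
by case: eqP => // ne; case: eqP => // ee; rewrite ee in ne.
Qed.

Definition single (t : 'I_n) (a : 'I_r) : mindex r n :=
  [ffun s => if s == t then a else Ordinal (ltnW hr)].

Lemma sum_single t a : (\sum_s single t a s = a)%N.
Proof.
rewrite (bigD1 t) //= ffunE eqxx big1 ?addn0 // => s /negbTE st.
by rewrite ffunE st.
Qed.

Lemma basis_single_mem (t : 'I_n) (l : nat) (lr : (l < r)%N) : t != o ->
  basis_vec R (single t (Ordinal lr)) \in last0_space l.
Proof.
move=> to; apply/memv_last0_space; split.
  by apply: basis_homog; rewrite sum_single.
by apply: basis_last0; rewrite ffunE eq_sym (negbTE to).
Qed.

Lemma Wnl_neq0 (t : 'I_n) l : t != o -> (l < r)%N -> W l != 0%VS.
Proof.
move=> to lr; apply/negP => /eqP W0.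
have := basis_single_mem lr to; rewrite /last0_space W0 limg0 memv0.
by rewrite (negbTE (basis_neq0 _)).
Qed.

(** Adding [l - l'] to entry [t] embeds [last0_space l'] in [last0_space l]; that entry is at most
    [l'], so it stays at most [l < r]. The basis vector with its whole degree at [t'] has entry 0 at
    [t], hence is not in the image. *)
Lemma dim_Wnl_lt (t t' : 'I_n) (l l' : nat) : t != o -> t' != o -> t != t' ->
  (l' < l)%N -> (l < r)%N -> (\dim (W l') < \dim (W l))%N.
Proof.
move=> to to' tt' ll lr; rewrite -!dim_last0_space.
pose psi : 'End(T) := linfun (pullback (fun eta => (l - l' <= eta t)%N)
  (fun eta => upd eta t (eta t - (l - l')))).
have psiE v eps : psi v eps = if (l - l' <= nindex_of eps t)%N then
    coord v (upd (nindex_of eps) t (nindex_of eps t - (l - l'))) else 0.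
  by rewrite lfunE /= ffunE.
have psi_inj v : homog l'%:Z v -> psi v = 0 -> v = 0.
  move=> /homogP hv pv; apply/ffunP => eps; rewrite [RHS]ffunE.
  case: (eqVneq (degree (nindex_of eps)) l'%:Z) => [e|/hv //].
  have el : (eps t <= l')%N.
    move: e; rewrite /degree (bigD1 t) //= ffunE => -[] <-.
    exact: leq_addr.
  have tr : (eps t + (l - l') < r)%N by lia.
  have /ffunP/(_ [ffun s => if s == t then Ordinal tr else eps s]) := pv.
  rewrite lfunE /= !ffunE eqxx /= leq_addl addnK -coordE => <-.
  congr (coord v _); apply/ffunP => s; rewrite !ffunE.
  by case: eqP => [->|].
rewrite -(limg_dim_eq (f := psi) (U := last0_space l')); last first.
  apply/eqP; rewrite -subv0; apply/subvP => v; rewrite memv_cap memv_ker memv0.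
  by move=> /andP[/memv_last0_space[hv _] /eqP v0]; apply/eqP/psi_inj.
rewrite (ltn_leqif (dimv_leqif_sup _)); last first.
  apply/subvP => _ /memv_imgP[v /memv_last0_space[/homogP hv v0] ->].
  apply/memv_last0_space; split.
    apply/homogP => eps el; rewrite psiE; case: ifP => // te.
    case: (nindexP r (upd (nindex_of eps) t (nindex_of eps t - (l - l'))))
      => [[e ee]|[s Hs]]; last by rewrite (coord_out _ Hs).
    rewrite ee coordE hv // -ee degree_upd; apply: contraNneq el => el.
    by apply/eqP; lia.
  apply/ffunP => eps; rewrite -!coordE coord_last0 !coordE psiE.
  case: (boolP (_ == _)) => // eo; case: ifP => // _.
  by rewrite -v0 coord_last0 updE (eq_sym o) (negbTE to) (negbTE eo).
apply/negP => /subvP /(_ _ (basis_single_mem lr to')) /memv_imgP[v _].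
move=> /ffunP /(_ (single t' (Ordinal lr))); rewrite lfunE /= !ffunE eqxx.
rewrite (negbTE tt') /= leqn0 (_ : (l - l' == 0)%N = false); last by lia.
by move=> /eqP; rewrite oner_eq0.
Qed.

(** With only two positions, degree [l] and last entry 0 leave a single index, so one coordinate
    determines a vector of [W l]. *)
Lemma Wnl_line (t : 'I_n) l v s : (forall s, (s == t) || (s == o)) -> t != o ->
  v \in W l -> s \in W l -> s != 0 -> v \in <[s]>%VS.
Proof.
move=> tE_ to vW sW s0.
have det u : u \in W l -> coord u [ffun x => if x == t then l else 0%N] = 0 -> u = 0.
  move=> /memv_Wnl[hu Eu] u0; apply: last0_inj => //.
  apply: coord_ext => eta; rewrite coord_last0 coord0; case: eqP => // eo.
  rewrite -hu coord_hproj; case: eqP => // el; rewrite -u0; congr (coord u _).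
  apply/ffunP => x; rewrite ffunE.
  have et : eta t = l.
    have ot : o != t by rewrite eq_sym.
    move: el; rewrite /degree (bigD1 t) //= (bigD1 o) //= eo big1 ?addn0.
      by case.
    move=> y /andP[yt yo]; have := tE_ y.
    by rewrite (negbTE yt) (negbTE yo).
  by have /orP[/eqP ->|/eqP ->] := tE_ x; rewrite ?eqxx // eq_sym (negbTE to).
set e := [ffun x => _] in det.
have se : coord s e != 0 by apply: contraNneq s0 => /det ->.
have : v - (coord v e / coord s e) *: s = 0.
  apply: det; first by rewrite memvB ?memvZ.
  rewrite addrC -scaleNr coord_linear mulNr divfK // addNr //.
by move/eqP; rewrite subr_eq0 => /eqP ->; rewrite memvZ ?memv_line.
Qed.

End HighestWeightSpaces.

(** * Highest weight vectors and the socle subrepresentation *)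

Section Assembly.
Variables (R : realType) (r n : nat).
Hypotheses (hr : (2 <= r)%N) (hn : (2 <= n)%N).
Local Notation C := R[i].
Local Notation T := (tensor R r n).
Local Notation tE := (tensE R r n).
Local Notation tF := (tensF R r n).
Local Notation D := (tensD R r n).
Local Notation W := (Wnl R r n).
Local Notation M := (kweight r n).
Local Notation "[ x ]" := (qint R r x).
Implicit Types (u v : T) (x y : int) (l j m : nat).

Variable d : decomposition R r n.
Let HD := dec_is_Dmodule d.

Definition PwH_degree (i : 'I_(nP d)) : nat := xchoose (dec_PwH_hom i).

Lemma PwH_homog i : homog (PwH_degree i)%:Z (PwH i).
Proof. exact/memv_Vnl/(xchooseP (dec_PwH_hom i)). Qed.

(** A zero generator would make the summand zero, whereas the projective cover surjects onto a
    module of dimension [m + 1]. *)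
Lemma PwH_neq0 i : PwH (d := d) i != 0.
Proof.
apply/negP => /eqP w0; have [[_ wU gen] _ _] := dec_PwH i.
have [A [[S [[_ _ dimS _] [_ [p [_ limp _]]]]] [f [_ kf imf]]]] := dec_Piso i.
have U0 : Psum i = 0%VS.
  apply/eqP; rewrite -subv0; apply: gen; last by rewrite w0 mem0v.
  by split; rewrite limg0 subvv.
have dimA : \dim {:A} = 0%N.
  by have := limg_ker_dim f fullv; rewrite kf capv0 dimv0 imf U0 dimv0.
have := limg_ker_dim p fullv; rewrite limp dimS dimA => /eqP.
by rewrite addnS.
Qed.

Lemma PwS_homog i : homog (PwH_degree i)%:Z (PwS (d := d) i).
Proof.
by have := homog_tensF hr (homog_tensE hr (PwH_homog i)); rewrite subrK.
Qed.

Lemma PwR_homog i :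
  homog ((PwH_degree i)%:Z - (r - 1 - Pm i)%N%:Z) (PwR (d := d) i).
Proof. exact: homog_iterE (PwH_homog i). Qed.

Lemma Pm_congr i : (r %| (Pm (d := d) i)%:Z - M (PwH_degree i)%:Z)%Z.
Proof.
have [_ kw _] := dec_PwH i.
exact: (weight_congr hr (PwH_homog i) (PwH_neq0 i) (dec_Palpha i) kw).
Qed.

Lemma Psum_structure i :
  [/\ PwS i != 0 /\ tE (PwS i) = 0, PwR i != 0 /\ tE (PwR i) = 0,
      exists2 c : C, c != 0 & iter (r - 1 - Pm i) tF (PwR i) = c *: PwS i &
      forall x u, u \in Psum (d := d) i -> homog x u -> tE u = 0 -> u != 0 ->
        (x = (PwH_degree i)%:Z /\ u \in <[PwS i]>%VS) \/
        (x = (PwH_degree i)%:Z - (r - 1 - Pm i)%N%:Z /\ u \in <[PwR i]>%VS)].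
Proof.
have [[_ wU gen] _ FE] := dec_PwH i.
apply: (projective_summand hr HD wU (PwH_neq0 i) (PwH_homog i) gen FE
  (dec_Pm i) (Pm_congr i)).
- exact: (@dec_summand_tensE _ _ _ d (inr i)).
- exact: (@dec_summand_tensF _ _ _ d (inr i)).
- exact: (@dec_summand_ker_tensE _ _ _ hr d hn (inr i)).
- exact: (@dec_summand_ker_tensF _ _ _ hr d hn (inr i)).
Qed.

Lemma Csum_hw (i : 'I_(nC d)) l v :
    v \in Csum i -> homog l%:Z v -> tE v = 0 -> v != 0 ->
  Cu0 i \in Vnl R r n l /\ v \in <[Cu0 i]>%VS.
Proof.
move=> vU hv Ev v0; have [A [[_ simA _ _] iso]] := dec_Ciso i.
have [uU u0 Eu _] := dec_Cu0 i.
have [hu vu] := simple_hw hr HD simA iso vU hv Ev v0 uU u0 Eu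
  (fun y u => graded_hproj y (dec_Cgraded i)).
by split=> //; apply/memv_Vnl.
Qed.

Lemma Wnl_decompose l : W l = (Cnl d l + Snl d l + Rnl d l)%VS.
Proof.
apply: subv_anti; apply/andP; split.
  apply/subvP => v /memv_Wnl[hv Ev].
  have [us usU e] := dec_split d v; rewrite e in hv Ev *.
  apply: memv_suml => k _.
  have hk := dec_split_homog usU hv k; have Ek := dec_split_tensE usU Ev k.
  case: (eqVneq (us k) 0) => [->|k0]; first exact: mem0v.
  case: k (usU k) hk Ek k0 => i uU hu Eu u0.
    have [iV ui] := Csum_hw uU hu Eu u0.
    apply: (subvP _ _ ui); apply: (subv_trans _ (addvSl _ _)).
    by apply: (subv_trans _ (addvSl _ _)); apply: (sumv_sup i).
  have [_ _ _ /(_ _ _ uU hu Eu u0)] := Psum_structure i.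
  case=> [[le ui]|[le ui]]; apply: (subvP _ _ ui).
    apply: (subv_trans _ (addvSl _ _)); apply: (subv_trans _ (addvSr _ _)).
    by apply: (sumv_sup i) => //; apply/memv_Vnl; rewrite le; apply: PwS_homog.
  apply: (subv_trans _ (addvSr _ _)).
  by apply: (sumv_sup i) => //; apply/memv_Vnl; rewrite le; apply: PwR_homog.
rewrite !subv_add; apply/andP; split; first (apply/andP; split);
  apply/subv_sumP => i /memv_Vnl hi; rewrite -memvE; apply/memv_Wnl; split=> //.
- by have [] := dec_Cu0 i.
- by have [[]] := Psum_structure i.
- by have [_ []] := Psum_structure i.
Qed.

(** * Weight congruences in degree [l] *)

Section Congruences.
Variables (l j : nat).
Hypotheses (hj : (j <= r - 1)%N)
  (hjmod : (j%:Z = n%:Z + 2 * (l%:Z - 1) %[mod r%:Z])%Z).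

(** Elimination of [n]: modulo [r], [M x] is [-n - 2x] and [j] is [n + 2(l - 1)]. For [w^S] one
    takes [x = l], which leaves [m + j + 2]; for [w^R] one takes [x = l + (r - 1 - m)], which leaves
    [j - m]. *)
Lemma index_congr m x : (r %| m%:Z - M x)%Z ->
  (r %| m%:Z + 2 * (x - l%:Z) + j%:Z + 2)%Z.
Proof.
move=> rm; have /eqP := hjmod; rewrite eqz_mod_dvd => rj.
rewrite (_ : _ + 2 = (m%:Z - M x) + (j%:Z - (n%:Z + 2 * (l%:Z - 1))) + n%:Z * r%:Z).
  by apply: rpredD (rpredD rm rj) _; apply: dvdz_mull; apply: dvdzz.
by rewrite /kweight PoszM -subzn; [ring|lia].
Qed.

Let dvd_lt_2r (k : nat) : (r %| k%:Z)%Z -> (0 < k < 2 * r)%N -> k = r.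
Proof.
rewrite dvdzE /= => /dvdnP[c ->] /andP[c0 c2].
have : (c < 2)%N by rewrite -(ltn_pmul2r (m := r)) //; lia.
by case: c c0 c2 => [|[|c]] //; rewrite mul1n.
Qed.

Lemma Cnl_eq0 : j != (r - 1)%N -> Cnl d l = 0%VS.
Proof.
move=> jr; rewrite /Cnl big_pred0 // => i; apply/negP => /memv_Vnl hu.
have [_ u0 _ ku] := dec_Cu0 i.
have := index_congr (weight_congr hr hu u0 (dec_Calpha i) ku).
rewrite (_ : _ + 2 = (j + 1)%N%:Z + r%:Z); last by lia.
rewrite rpredDr ?dvdzz // => /dvd_lt_2r; lia.
Qed.

Lemma PwS_index i : PwS (d := d) i \in Vnl R r n l ->
  PwH_degree i = l /\ (Pm i + j + 2 = r)%N.
Proof.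
move=> /memv_Vnl hl; have [[S0 _] _ _ _] := Psum_structure i.
have [e] := homog_inj (PwS_homog i) hl S0; split=> //.
have := index_congr (Pm_congr i); rewrite e.
rewrite (_ : _ + 2 = (Pm i + j + 2)%N%:Z); last by lia.
by move/dvd_lt_2r; apply; have := dec_Pm i; lia.
Qed.

Lemma PwR_index i : PwR (d := d) i \in Vnl R r n l ->
  PwH_degree i = (l + (r - 1 - Pm i))%N /\ Pm i = j.
Proof.
move=> /memv_Vnl hl; have [_ [R0 _] _ _] := Psum_structure i.
have e := homog_inj (PwR_homog i) hl R0; have hm := dec_Pm i.
have dl : PwH_degree i = (l + (r - 1 - Pm i))%N by lia.
split=> //; have := index_congr (Pm_congr i); rewrite dl.
rewrite (_ : _ + 2 = (r + j - Pm i)%N%:Z + r%:Z); last by lia.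
by rewrite rpredDr ?dvdzz // => /dvd_lt_2r; lia.
Qed.

(** A vector [w^S] in degree [l] has [m = r - 2 - j], so the [w^R] of the same summand would have
    the negative degree [l - j - 1], although it is nonzero. *)
Lemma Snl_eq0 : (l <= j)%N -> Snl d l = 0%VS.
Proof.
move=> lj; rewrite /Snl big_pred0 // => i; apply/negP => /PwS_index[di mi].
have [_ [/negP R0 _] _ _] := Psum_structure i; apply: R0; apply/eqP.
by apply: (homog_neg hr (PwR_homog i)); lia.
Qed.

Lemma Rnl_eq0 : j = (r - 1)%N -> Rnl d l = 0%VS.
Proof.
move=> jr; rewrite /Rnl big_pred0 // => i; apply/negP => /PwR_index[_ mi].
by have := dec_Pm i; lia.
Qed.

Lemma Wnl_eq_Cnl : (l < r)%N -> j = (r - 1)%N -> W l = Cnl d l.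
Proof.
by move=> lr jr; rewrite Wnl_decompose Snl_eq0 ?Rnl_eq0 ?addv0 //; lia.
Qed.

Lemma Wnl_eq_Rnl : (l <= j)%N -> (j < r - 1)%N -> W l = Rnl d l.
Proof.
by move=> lj jr; rewrite Wnl_decompose Snl_eq0 ?Cnl_eq0 ?add0v //; lia.
Qed.

Lemma Wnl_eq_SRnl : (j < r - 1)%N -> W l = (Snl d l + Rnl d l)%VS.
Proof. by move=> jr; rewrite Wnl_decompose Cnl_eq0 ?add0v //; lia. Qed.

(** A summand never contributes to both spaces: its [w^R] lies [r - 1 - m > 0] degrees below its
    [w^S]. Uniqueness of components does the rest. *)
Lemma Snl_capv_Rnl : (Snl d l :&: Rnl d l = 0)%VS.
Proof.
apply/eqP; rewrite -subv0; apply/subvP => v.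
rewrite memv_cap memv0 => /andP[/memv_sumP[ss ssP vs] /memv_sumP[ts tsP vt]].
pose us (k : dec_index d) :=
  match k with inl _ => 0 | inr i => if PwS i \in Vnl R r n l then ss i else 0 end.
pose ws (k : dec_index d) :=
  match k with inl _ => 0 | inr i => if PwR i \in Vnl R r n l then ts i else 0 end.
have sub (i : 'I_(nP d)) u : u \in <[PwS i]>%VS \/ u \in <[PwR i]>%VS -> u \in Psum i.
  have wU : PwH i \in Psum i by have [[]] := dec_PwH i.
  have EU := @dec_summand_tensE _ _ _ d (inr i).
  have FU := @dec_summand_tensF _ _ _ d (inr i).
  case=> /vlineP[a ->]; rewrite memvZ //; first exact/FU/EU.
  exact: iter_lfun_mem EU wU.
have eq : \sum_k us k = \sum_k ws k.
  by rewrite !big_sumType /= !big1_eq !add0r -!big_mkcond -vs -vt.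
have usU k : us k \in dec_summand k.
  case: k => i /=; first exact: mem0v.
  by case: ifP => [iV|_]; [apply: sub; left; apply: ssP|exact: mem0v].
have wsU k : ws k \in dec_summand k.
  case: k => i /=; first exact: mem0v.
  by case: ifP => [iV|_]; [apply: sub; right; apply: tsP|exact: mem0v].
rewrite vs big1 // => i iV; have /= := dec_unique2 usU wsU eq (inr i).
rewrite iV; case: ifP => // /PwR_index[di mi] _.
by have [di' _] := PwS_index iV; have := dec_Pm i; lia.
Qed.

End Congruences.
Lemma Wnl_subrep l : is_subrep (W l).
Proof.
move=> b; apply/subvP => _ /memv_imgP[v /memv_Wnl[hv Ev] ->]; apply/memv_Wnl.
pose p : 'End(T) := linfun (hproj l%:Z).
have pE u : p u = hproj l%:Z u by rewrite lfunE.
split.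
  rewrite /homog -pE (@braid_comm _ _ _ hr p) ?pE ?hv // => i u.
  by rewrite !pE hproj_sigma.
rewrite (@braid_comm _ _ _ hr tE) ?Ev ?linear0 // => i u.
by rewrite sigma_tensE.
Qed.

Definition lfun_iter (f : 'End(T)) t : 'End(T) := iter t (comp_lfun f) \1%VF.

Lemma lfun_iterE f t v : lfun_iter f t v = iter t f v.
Proof. by elim: t => [|t IH] /=; rewrite ?id_lfunE // comp_lfunE IH. Qed.

Lemma rep_iso_limg (f : 'End(T)) (U : {vspace T}) :
    is_subrep U -> (forall i u, f (sigma R r i u) = sigma R r i (f u)) ->
    {in U, forall u, f u = 0 -> u = 0} ->
  is_subrep (f @: U)%VS /\ rep_iso (f @: U)%VS U.
Proof.
move=> subU comm inj.
have commb b v : f (braid_act R r b v) = braid_act R r b (f v).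
  exact: (braid_comm hr).
have subfU : is_subrep (f @: U)%VS.
  move=> b; apply/subvP => _ /memv_imgP[_ /memv_imgP[v vU ->] ->].
  by rewrite -commb memv_img // (subvP (subU b)) // memv_img.
split=> //; split=> //.
(* [f] is assumed injective on [U] only, so it is precomposed with the projection onto [U] before
   the formal inverse is taken; [g] then inverts [f] on [U]. *)
pose g : 'End(T) := (projv U \o (f \o projv U)^-1)%VF.
have gf u : u \in U -> g (f u) = u.
  move=> uU; rewrite comp_lfunE.
  set z := (_^-1)%VF _; have zU : projv U z \in U by apply: memv_proj.
  have fz : f (projv U z) = f u.
    have := @limg_lfunVK _ _ _ (f \o projv U)%VF (f u).
    rewrite comp_lfunE; apply; apply/memv_imgP; exists u; first exact: memvf.
    by rewrite comp_lfunE projv_id.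
  apply/eqP; rewrite -subr_eq0; apply/eqP; apply: inj; first exact: memvB.
  by rewrite linearB /= fz subrr.
exists g; split.
- apply: subv_anti; apply/andP; split; apply/subvP => v.
    by move=> /memv_imgP[_ /memv_imgP[u uU ->] ->]; rewrite gf.
  by move=> vU; rewrite -(gf v vU) !memv_img.
- apply/eqP; rewrite -subv0; apply/subvP => v; rewrite memv_cap memv_ker memv0.
  by move=> /andP[/eqP gv /memv_imgP[u uU e]]; rewrite e -(gf u uU) -e gv linear0.
- move=> b _ /memv_imgP[u uU ->]; rewrite -commb !gf //.
  by rewrite (subvP (subU b)) // memv_img.
Qed.

(** * The subrepresentation [S_(n,l)] as the image of a power of [F] *)

Section SocleSubrepresentation.
Variables (l j : nat).
Hypotheses (hl : (l < r)%N) (hjl : (j < l)%N)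
  (hjmod : (j%:Z = n%:Z + 2 * (l%:Z - 1) %[mod r%:Z])%Z).
Let l' := (l - j - 1)%N.
(** The residue attached to [l'], since [j - 2(j + 1) = -j - 2]. It is also the [m] of the summands
    with [w^S] in degree [l], whose [w^R] lies [r - 1 - j' = j + 1] degrees lower, in degree
    [l']. *)
Let j' := (r - 2 - j)%N.

Let j_le : (j <= r - 1)%N.
Proof. by move: hl hjl; clear; lia. Qed.

Let j'_le : (j' <= r - 1)%N.
Proof. by rewrite /j'; move: hl hjl; clear; lia. Qed.

Let j'E_nat : (r - 1 - j' = j.+1)%N.
Proof. by rewrite /j'; move: hl hjl; clear; lia. Qed.

Let l'E : l'%:Z = l%:Z - j%:Z - 1.
Proof. by rewrite /l'; move: hjl; clear; lia. Qed.

Let j'E : j'%:Z = r%:Z - 2 - j%:Z.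
Proof. by rewrite /j'; move: hl hjl; clear; lia. Qed.

Let hjmod' : (j'%:Z = n%:Z + 2 * (l'%:Z - 1) %[mod r%:Z])%Z.
Proof.
apply/eqP; rewrite eqz_mod_dvd; have /eqP := hjmod; rewrite eqz_mod_dvd => rj.
rewrite (_ : _ - _ = (j%:Z - (n%:Z + 2 * (l%:Z - 1))) + r%:Z); last by rewrite j'E l'E; ring.
by rewrite rpredD ?dvdzz.
Qed.

Let W'E : W l' = Rnl d l'.
Proof.
apply: (Wnl_eq_Rnl (j := j')); [|exact: hjmod'| |]; rewrite /l' /j';
  move: hl hjl; clear; lia.
Qed.

Definition lowering : 'End(T) := lfun_iter tF j.+1.

(** [F^j v] has degree [l - 1 < r - 1], where [F] is injective, so [F^j v = 0]. But [E^j F^j v] is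
    [v] times the product of [[i + 1][M l' - i]] over [i < j], and [M l'] is congruent to [j], so no
    factor vanishes. *)
Lemma lowering_inj : {in W l', forall v, lowering v = 0 -> v = 0}.
Proof.
move=> v /memv_Wnl[hv Ev]; rewrite lfun_iterE /= => Fv.
have F0 : iter j tF v = 0.
  apply: (ker_tensF_low hr HD hn (homog_iterF hr j hv)) => //.
  by rewrite l'E; move: hl hr; clear; lia.
have := iterE_iterF hr HD j hv Ev; rewrite F0 iter_lfun0 => /esym/eqP.
rewrite scaler_eq0 => /orP[/prodf_eq0[i _]|/eqP //].
have ij := ltn_ord i; rewrite mulf_eq0 !qint_eq0 //.
have small (k : nat) : (0 < k < r)%N -> (r %| k%:Z)%Z = false.
  by move=> /andP[k0 kr]; rewrite dvdzE /= gtnNdvd.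
rewrite small ?orFb; last by move: ij hl hjl; clear; lia.
have := hjmod' => /eqP; rewrite eqz_mod_dvd => rj ri.
have : (r %| (j - i)%N%:Z)%Z.
  rewrite (_ : (j - i)%N%:Z = (M l'%:Z - i%:Z) - (j'%:Z - (n%:Z + 2 * (l'%:Z - 1)))
    + (1 - n%:Z) * r%:Z).
    by apply: rpredD (rpredB ri rj) _; apply: dvdz_mull; apply: dvdzz.
  rewrite /kweight PoszM j'E l'E -!subzn; [ring|exact: ltnW hr|exact: ltnW ij].
by rewrite small //; move: ij hl hjl; clear; lia.
Qed.

Lemma lowering_img : (lowering @: W l')%VS = Snl d l.
Proof.
apply: subv_anti; apply/andP; split.
  rewrite W'E /Rnl limg_sum; apply/subv_sumP => i iV.
  have [di mi] := PwR_index j'_le hjmod' iV.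
  have [_ _ [c c0 Fc] _] := Psum_structure i.
  rewrite limg_line lfun_iterE -j'E_nat -mi.
  rewrite Fc -memvE memvZ //; apply: (subvP (sumv_sup i _ (subvv _))); last exact: memv_line.
  apply/memv_Vnl; have := PwS_homog i; rewrite di mi j'E_nat.
  by rewrite (_ : (l' + _)%N = l) // /l'; move: hjl; clear; lia.
apply/subv_sumP => i iV.
have [di mi] := PwS_index j_le hjmod iV.
have [_ [_ ER] [c c0 Fc] _] := Psum_structure i.
have e : j.+1 = (r - 1 - Pm i)%N by move: mi; clear; lia.
rewrite -memvE -(scalerK c0 (PwS i)) -Fc -e memvZ // -lfun_iterE memv_img //.
apply/memv_Wnl; split=> //; have := PwR_homog i; rewrite di.
by rewrite -e (_ : _ - _ = l'%:Z) // l'E; move: hjl; clear; lia.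
Qed.

Lemma Snl_rep : is_subrep (Snl d l) /\ rep_iso (Snl d l) (W l').
Proof.
rewrite -lowering_img; apply: rep_iso_limg lowering_inj; first exact: Wnl_subrep.
move=> i u; rewrite !lfun_iterE; elim: j.+1 => //= t ->.
by rewrite sigma_tensF.
Qed.

Lemma Snl_neq0 : Snl d l != 0%VS.
Proof.
have h0 : (0 < n)%N := ltnW hn.
have hlast : (n.-1 < n)%N by rewrite ltn_predL.
have W0 : W l' != 0%VS.
  apply: (@Wnl_neq0 _ _ _ hr (Ordinal hlast) _ HD (Ordinal h0)); rewrite -?val_eqE /l' /=; move: hn hl; clear; lia.
rewrite -lowering_img; apply: contraNneq W0 => G0; rewrite -subv0; apply/subvP => v vW.
rewrite memv0; apply/eqP/lowering_inj => //; apply/eqP; rewrite -memv0 -G0.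
exact: memv_img.
Qed.

Lemma Snl_sub : (Snl d l <= W l)%VS.
Proof. by rewrite Wnl_decompose; apply: subv_trans (addvSl _ _); apply: addvSr. Qed.

(** [S_(n,l)] is proper because its dimension is at most that of [W l'], which is smaller than that
    of [W l] as soon as there are two positions besides the last. *)
Lemma Wnl_not_simple : (3 <= n)%N -> ~ is_simple_rep (W l).
Proof.
move=> n3 [_ _ /(_ _ (proj1 Snl_rep) Snl_sub)[/eqP|SW]].
  by rewrite (negbTE Snl_neq0).
have h0 : (0 < n)%N := ltnW hn.
have h1 : (1 < n)%N := hn.
have hlast : (n.-1 < n)%N by rewrite ltn_predL.
have : (\dim (W l') < \dim (W l))%N.
  apply: (@dim_Wnl_lt _ _ _ hr (Ordinal hlast) _ HD (Ordinal h0) (Ordinal h1));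
  rewrite -?val_eqE /l' /=; move: n3 hl hjl; clear; lia.
rewrite -SW -lowering_img; have := limg_ker_dim lowering (W l') => <-.
by rewrite ltnNge leq_addl.
Qed.

(** For two factors [W l] is at most a line, and it contains the nonzero space [S_(2,l)]. *)
Lemma Wnl_eq_Snl : n = 2%N -> W l = Snl d l.
Proof.
move=> n2; apply: subv_anti; rewrite Snl_sub andbT.
have h0 : (0 < n)%N := ltnW hn.
have h1 : (1 < n)%N := hn.
apply/subvP => v vW; have sS := memv_pick (Snl d l).
have s0 : vpick (Snl d l) != 0 by rewrite vpick0 Snl_neq0.
suff : v \in <[vpick (Snl d l)]>%VS by apply: subvP.
apply: (Wnl_line hr (o := Ordinal h1) _ (t := Ordinal h0) _ _ vW (subvP Snl_sub _ sS) s0) => //=.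
move=> x; rewrite -!val_eqE /=; case: x => x /=; rewrite n2; clear; lia.
Qed.

End SocleSubrepresentation.
End Assembly.

Theorem theorem2p20 (R : realType) (n r l j : nat)
    (hn : (2 <= n)%N) (hr : (2 <= r)%N) (hl : (l < r)%N)
    (hj : (j <= r - 1)%N)
    (hjmod : (j%:Z = n%:Z + 2 * (l%:Z - 1) %[mod r%:Z])%Z)
    (d : decomposition R r n) :
  [/\ j = (r - 1)%N -> Wnl R r n l = Cnl d l,
      (l <= j)%N -> (j < r - 1)%N -> Wnl R r n l = Rnl d l,
      (j < l)%N -> (3 <= n)%N ->
        [/\ Wnl R r n l = (Snl d l + Rnl d l)%VS,
            (Snl d l :&: Rnl d l)%VS = 0%VS,
            is_subrep (Wnl R r n l) /\ ~ is_simple_rep (Wnl R r n l) &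
            is_subrep (Snl d l) /\
            rep_iso (Snl d l) (Wnl R r n (l - j - 1))] &
      (j < l)%N -> n = 2%N -> Wnl R r n l = Snl d l].
Proof.
split.
- by move=> jr; apply: Wnl_eq_Cnl hj hjmod hl jr.
- by move=> lj jr; apply: Wnl_eq_Rnl hj hjmod lj jr.
- move=> jl n3; have jr : (j < r - 1)%N by move: hl jl; clear; lia.
  split; [|exact: Snl_capv_Rnl hj hjmod| |exact (Snl_rep hr hn d hl jl hjmod)].
    exact: Wnl_eq_SRnl hj hjmod jr.
  split; first exact (Wnl_subrep R hr l).
  exact (Wnl_not_simple hr hn d hl jl hjmod n3).
- by move=> jl n2; exact (Wnl_eq_Snl hr hn d hl jl hjmod n2).
Qed.
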